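(* Given a type $\sigma$ and a sequence of blocks $\delta = (d_1^{r_1}, \ldots, d_{s}^{r_s})$, \[ s_\sigma^\otimes H_{\delta} = \sum_{\tau} \left[\sum_{T\in\mathrm{TPRT}(\tau/\sigma,\delta)} \operatorname{sgn}(T)\right] s_{\tau}^{\otimes}, \] where the outer sum is over types $\tau$ and $\mathrm{TPRT}(\tau/\sigma,\delta)$ is the set of tensor polyribbon tableaux of shape $\tau/\sigma$ and content $\delta$.
   Context: An integer partition is a finite (possibly empty) weakly decreasing sequence of positive integers; $m_k(\lambda)$ is the number of parts of $\lambda$ equal to $k$. A block is an ordered pair of positive integers written $d^m$ (degree $d$, multiplicity $m$). Blocks are ordered by $a^b\ge d^e$ iff $a>d$, or $a=d$ and $b\ge e$. A type is a finite (possibly empty) weakly decreasing sequence of blocks. For $k\ge1$, $\tau|_k$ denotes the integer partition formed by the multiplicities of the blocks of $\tau$ of degree $k$; the type $\tau$ is determined by $(\tau|_k)_{k\ge1}$. Variables: $x_{k,j}$ for $k,j\ge 1$, with $\deg x_{k,j}=k$; $\mathbf{x}_{k*}=(x_{k,1},x_{k,2},\dots)$. The algebra $\mathsf{P\Lambda}$ of polysymmetric functions consists of the formal series over $\mathbb{Q}$ of bounded degree in all the $x_{k,j}$ that, for each fixed $k$, are unchanged by any permutation of the variables $\mathbf{x}_{k*}$. Define $s^{\otimes}_\tau=\prod_{k\ge1}s_{\tau|_k}(\mathbf{x}_{k*})$, where $s_\lambda$ is the Schur symmetric function. $H_d$ is the sum of all distinct monomials of degree $d$ in the variables $x_{k,j}$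 (with $\deg x_{k,j}=k$), $H_{d^r}$ is obtained from $H_d$ by replacing every variable $x_{k,j}$ by $x_{k,j}^r$, and $H_\delta=\prod_{i=1}^sH_{d_i^{r_i}}$ for an ordered sequence of blocks $\delta=(d_1^{r_1},\dots,d_s^{r_s})$. The diagram $\mathrm{dg}(\mu)$ is the set of boxes $(i,j)$ with $1\le i\le\ell(\mu)$, $1\le j\le\mu_i$ (row $1$ at the top). For $\mathrm{dg}(\mu)\subseteq\mathrm{dg}(\nu)$, $\nu/\mu=\mathrm{dg}(\nu)\setminus\mathrm{dg}(\mu)$. It is an $r$-ribbon if it consists of $r$ boxes that can be labeled $b_1,\dots,b_r$ so that for $1<i\le r$, $b_i$ is one unit left of or one unit below $b_{i-1}$. If a ribbon $R$ has boxes in exactly $q$ different rows, $\operatorname{sgn}(R)=(-1)^{q-1}$, and $\mathrm{top}(R)$ is the least index of a row containing a box of $R$. A skew shape $\lambda/\mu$ is an $r^n$-polyribbon ($n\ge0$) if there exist partitions $\mu=\gamma_{(0)}\subseteq\gamma_{(1)}\subseteq\cdots\subseteq\gamma_{(n)}=\lambda$ such that $\gamma_{(i)}/\gamma_{(i-1)}$ is an $r$-ribbon for $1\le i\le n$ and $\mathrm{top}(\gamma_{(i)}/\gamma_{(i-1)})\ge\mathrm{top}(\gamma_{(i+1)}/\gamma_{(i)})$ for $1\le i\le n-1$ (such a list is unique if it exists; for $n=0$ the shape is empty). Its sign is $\operatorname{sgn}_r(\lambda/\mu)=\prod_{i=1}^n\operatorname{sgn}(\gamma_{(i)}/\gamma_{(i-1)})$.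 For types $\tau,\sigma$, $\tau/\sigma$ is a $d^r$-tensor polyribbon if for some partition $\lambda$ of $d$, $(\tau|_k)/(\sigma|_k)$ is an $r^{m_k(\lambda)}$-polyribbon for all $k\ge1$; then $\operatorname{sgn}_r^\otimes(\tau/\sigma)=\prod_{k\ge1}\operatorname{sgn}_r((\tau|_k)/(\sigma|_k))$. A tensor polyribbon tableau (TPRT) $T$ of shape $\tau/\sigma$ and content $\delta$ is a sequence of types $\sigma=\tau_{(0)},\tau_{(1)},\dots,\tau_{(s)}=\tau$ such that, for $1\le i\le s$, $\tau_{(i)}/\tau_{(i-1)}$ is a $d_i^{r_i}$-tensor polyribbon. Its sign is $\operatorname{sgn}(T)=\prod_{i=1}^s\operatorname{sgn}_{r_i}^\otimes(\tau_{(i)}/\tau_{(i-1)})$. *)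

(* Defs.v *)
From HB Require Import structures.
From mathcomp Require Import all_boot all_order all_algebra finmap.
From mathcomp Require Import boolp classical_sets functions cardinality fsbigop.
From mathcomp.multinomials Require Import monalg.

Set Implicit Arguments.
Unset Strict Implicit.
Unset Printing Implicit Defensive.

Import Order.TTheory GRing.Theory Num.Theory.

Local Open Scope classical_set_scope.
Local Open Scope ring_scope.

Record pnat := PNat { pval :> nat; _ : (0 < pval)%N }.
HB.instance Definition _ := [isSub for pval].
HB.instance Definition _ := [Countable of pnat by <:].

Record intpart :=
  IntPart { parts :> seq nat; _ : sorted geq parts && all (ltn 0) parts }.
HB.instance Definition _ := [isSub for parts].
HB.instance Definition _ := [Countable of intpart by <:].

Definition mult (k : nat) (la : intpart) : nat := count_mem k (parts la).

(* The block d^m is the pair (d, m). *)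
Definition block : Type := pnat * pnat.
HB.instance Definition _ := Countable.on block.

Definition block_ge (b c : block) : bool :=
  ((c.1 < b.1) || ((b.1 == c.1 :> nat) && (c.2 <= b.2)))%N.

Record ptype := PType { blocks :> seq block; _ : sorted block_ge blocks }.
HB.instance Definition _ := [isSub for blocks].
HB.instance Definition _ := [Countable of ptype by <:].

Lemma block_ge_trans : transitive block_ge.
Proof.
move=> b a c; rewrite /block_ge => /orP[ab|/andP[/eqP ab ab2]].
  case/orP=> [bc|/andP[/eqP <- _]]; last by rewrite ab.
  by rewrite (ltn_trans bc ab).
rewrite ab; case/orP=> [->//|/andP[-> bc2]].
by rewrite (leq_trans bc2 ab2) orbT.
Qed.

Lemma restr_subproof (tau : ptype) (k : nat) :
  let s := [seq pval b.2 | b : block <- blocks tau & pval b.1 == k] in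
  sorted geq s && all (ltn 0) s.
Proof.
apply/andP; split; last by apply/allP => _ /mapP[b _ ->]; case: (b.2).
rewrite sorted_map.
have := sorted_filter block_ge_trans (fun b : block => pval b.1 == k)
  (valP tau).
have: all (fun b : block => pval b.1 == k)
  [seq b <- val tau | pval b.1 == k] by apply: filter_all.
elim: [seq b <- val tau | pval b.1 == k] => [//|a [//|b u] IH].
move=> /= /and3P[/eqP ak /eqP bk uk] /andP[ab pu].
move: ab; rewrite /block_ge ak bk ltnn eqxx /= => -> /=.
by apply: IH => //=; rewrite bk eqxx.
Qed.

(* The partition of the multiplicities of the blocks of degree k. *)
Definition restr (tau : ptype) (k : nat) : intpart :=
  IntPart (restr_subproof tau k).

(* The pair (k, j) stands for the variable x_{k,j}, of degree k. *)
Definition var : Type := pnat * pnat.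
HB.instance Definition _ := Countable.on var.

Definition monom : Type := {cmonom var}.
HB.instance Definition _ := ConomialDef.on monom.

Definition weight (m : monom) : nat :=
  (\sum_(v <- finsupp (cmonom_val m)) v.1 * m v)%N.

(* A formal series is its family of coefficients. The sum and the scaling are
   the pointwise ones; the product of series is [smul], NOT the pointwise
   product [*%R] of functions. *)
Definition series : Type := monom -> rat.
HB.instance Definition _ := GRing.Lmodule.copy series (monom -> rat^o).

Definition sone : series := fun m => (m == mone)%:R.

(* Cauchy product; every monomial has finitely many factorizations. *)
Definition smul (f g : series) : series := fun m =>
  \sum_(p \in [set p : monom * monom | mmul p.1 p.2 = m]) f p.1 * g p.2.

(* The tableau is given by the sequence of its rows, from top to bottom. *)
Definition ssyt (la : intpart) (T : seq (seq pnat)) : bool :=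
  [&& shape T == parts la,
      all (sorted (fun i j : pnat => i <= j)%N) T &
      sorted (fun r1 r2 : seq pnat =>
        all (fun p : pnat * pnat => p.1 < p.2)%N (zip r1 r2)) T].

Definition tableau_monom (k : pnat) (T : seq (seq pnat)) : monom :=
  \big[@mmul monom/mone]_(j <- flatten T) ucm ((k, j) : var).

(* The Schur function s_la in the variables x_{k,1}, x_{k,2}, ... : the
   coefficient of a monomial is the number of semistandard tableaux of shape
   la with this monomial. *)
Definition schur (k : pnat) (la : intpart) : series := fun m =>
  \sum_(T \in [set T | ssyt la T /\ tableau_monom k T = m]) (1 : rat).

(* Almost all factors are equal to [sone]. *)
Definition schur_tensor (tau : ptype) : series :=
  \big[smul/sone]_(k \in [set: pnat]) schur k (restr tau k).

Definition Hdeg (d : nat) : series := fun m => (weight m == d)%:R.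

(* Substitution of x_{k,j}^r for each x_{k,j}, which maps the monomial m to
   m^r. *)
Definition power_vars (r : pnat) (f : series) : series := fun m =>
  \sum_(m' \in [set m' : monom | expcmn m' r = m]) f m'.

Definition Hblock (b : block) : series := power_vars b.2 (Hdeg b.1).

Definition Hseq (delta : seq block) : series :=
  \big[smul/sone]_(b <- delta) Hblock b.

(* Boxes are pairs (row, column), numbered from 1. *)
Definition dg (mu : intpart) : seq (nat * nat) :=
  [seq (i, j) | i <- iota 1 (size mu), j <- iota 1 (nth 0%N mu i.-1)].

Definition skew_shape (nu mu : intpart) : seq (nat * nat) :=
  [seq b <- dg nu | b \notin dg mu].

Definition ribbon_step (b c : nat * nat) : bool :=
  (((c.1 == b.1) && (c.2.+1 == b.2)) || ((c.1 == b.1.+1) && (c.2 == b.2)))%N.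

Definition is_ribbon (r : nat) (nu mu : intpart) : bool :=
  [&& all (mem (dg nu)) (dg mu), size (skew_shape nu mu) == r &
      has (sorted ribbon_step) (permutations (skew_shape nu mu))].

Definition ribbon_sgn (nu mu : intpart) : rat :=
  (-1) ^+ (size (undup [seq b.1 | b <- skew_shape nu mu])).-1.

Definition ribbon_top (nu mu : intpart) : nat :=
  head 0%N (sort leq [seq b.1 | b <- skew_shape nu mu]).

(* [gs] is the list gamma_(1), ..., gamma_(n), and gamma_(0) = mu. *)
Definition ribbon_chain (r : nat) (la mu : intpart) (gs : seq intpart) : bool :=
  [&& path (fun g g' => is_ribbon r g' g) mu gs, last mu gs == la &
      sorted geq (pairmap (fun g g' => ribbon_top g' g) mu gs)].

Definition is_polyribbon (r n : nat) (la mu : intpart) : Prop :=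
  exists gs, size gs = n /\ ribbon_chain r la mu gs.

(* The chain of a polyribbon is unique; the value is meaningless when la / mu
   is not an r^n-polyribbon for any n. *)
Definition polyribbon_sgn (r : nat) (la mu : intpart) : rat :=
  let gs := xget [::] [set gs | ribbon_chain r la mu gs] in
  \prod_(e <- pairmap (fun g g' => ribbon_sgn g' g) mu gs) e.

Definition is_tensor_polyribbon (b : block) (tau sigma : ptype) : Prop :=
  exists la : intpart, sumn la = b.1 /\
    forall k : pnat, is_polyribbon b.2 (mult k la) (restr tau k) (restr sigma k).

(* Almost all factors are equal to 1. *)
Definition tensor_sgn (r : nat) (tau sigma : ptype) : rat :=
  \big[*%R/1]_(k \in [set: pnat])
    polyribbon_sgn r (restr tau k) (restr sigma k).

(* A tableau is the full sequence tau_(0), ..., tau_(s), with s = size delta.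
   In [nth sigma T i], sigma is a default value that is never reached. *)
Definition TPRT (tau sigma : ptype) (delta : seq block) : set (seq ptype) :=
  [set T | [/\ size T = (size delta).+1, nth sigma T 0 = sigma,
     nth sigma T (size delta) = tau &
     forall i : 'I_(size delta), is_tensor_polyribbon
       (tnth (in_tuple delta) i) (nth sigma T i.+1) (nth sigma T i)]].

Definition TPRT_sgn (sigma : ptype) (delta : seq block) (T : seq ptype) : rat :=
  \prod_(i < size delta)
    tensor_sgn (tnth (in_tuple delta) i).2 (nth sigma T i.+1) (nth sigma T i).

(* Main.v *)
(* Write a partition with at most N rows as the decreasing sequence of its beads
   la_j + N - 1 - j. Adding an r-ribbon moves one bead p to the free position
   v = p + r; the sign records the number of beads jumped over, and the top row
   is one more than the number of beads above v. The tops of consecutive ribbons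
   weakly decrease exactly when the targets v strictly increase, so a polyribbon
   is a sequence of moves with increasing targets, which is unique because the
   least target at which two sequences differ leaves its source occupied in only
   one of the two results.

   In N variables, the Schur function times the Vandermonde product is the
   alternant det (x_i ^ a_j) of the beads a_j, since both sides obey the same
   branching rule when the last variable is removed. Multiplying this alternant by
   prod_i 1 / (1 - u x_i ^ r), the generating function of the complete functions
   in the r-th powers, replaces each row x ^ a by the sum of u ^ j x ^ (a + r j).
   Treating the targets v one at a time, in increasing order, multilinearity in
   the row of exponent v - r splits the determinant into the term where that bead
   stays and the term where it moves to v, and the latter vanishes when v is
   occupied. No other cancellation is needed. This gives the rule for one
   alphabet. The theorem follows by splitting H_(d^r) according to the degrees of
   the variables, and by induction on delta. *)

From HB Require Import structures.
From mathcomp Require Import all_boot all_order all_algebra.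
From mathcomp Require Import finmap perm zify.
From mathcomp Require Import boolp classical_sets functions cardinality fsbigop.
From mathcomp.multinomials Require Import monalg.
Require Import Defs.

Set Implicit Arguments.
Unset Strict Implicit.
Unset Printing Implicit Defensive.
Import Order.TTheory GRing.Theory Num.Theory.

(** * Alternants and their branching rule *)

Local Open Scope ring_scope.

(** The overview works in N variables and compares two multiples of the Vandermonde product; both
    steps need care for formal series in infinitely many variables. An identity of series is checked
    one monomial m at a time, and N is chosen after m: large enough for the variables of m, and at
    least |mu| + r n, so that every partition in the result has at most N rows. Division by the
    Vandermonde product is replaced by the fact that the difference of two variables is not a zero
    divisor, which avoids fractions. The generating function in u is truncated after u^n, so that
    determinants are taken over a polynomial ring; the error is a multiple of u^(n+1), invisible in
    the coefficients of degree at most n that are read. Uniqueness of the chain of a polyribbon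
    matters twice: it makes distinct move sequences give distinct shapes, and it gives a meaning to
    the sign, which is defined through a chosen chain. The possibly infinite index sets of the
    statement are handled through explicit duplicate-free lists. *)

Fixpoint choices (T : Type) (s : seq (seq T)) : seq (seq T) :=
  if s is A :: s' then [seq c :: cs | c <- A, cs <- choices s'] else [:: [::]].

Lemma prod_sum_choices (R : comPzRingType) (s : seq (seq nat))
    (F : nat -> nat -> R) :
  \prod_(j < size s) \sum_(c <- nth [::] s j) F j c =
  \sum_(cs <- choices s) \prod_(j < size s) F j (nth 0%N cs j).
Proof.
elim: s F => [|A s IH] F /=; first by rewrite big_seq1 !big_ord0.
rewrite big_ord_recl /= (IH (fun j => F j.+1)) big_allpairs_dep mulr_suml.
apply: eq_bigr => c _; rewrite mulr_sumr; apply: eq_bigr => cs _.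
by rewrite big_ord_recl.
Qed.

Lemma mem_choices (T : eqType) x0 (s : seq (seq T)) (cs : seq T) :
  (cs \in choices s) =
  (size cs == size s) && all (fun j => nth x0 cs j \in nth [::] s j) (iota 0 (size s)).
Proof.
elim: s cs => [|A s IH] cs /=.
  by rewrite inE andbT size_eq0.
case: cs => [|c cs] /=; first by apply/negP => /allpairsP[[]] ? ? [].
rewrite (iotaDl 1) all_map eqSS; apply/allpairsP/idP.
  by case=> -[c' cs'] /= [cI csI [-> ->]]; move: csI; rewrite IH cI.
case/and3P=> sz cI h; exists (c, cs); split=> //=; rewrite IH sz /=.
exact: h.
Qed.

Lemma uniq_choices (T : eqType) (s : seq (seq T)) :
  all uniq s -> uniq (choices s).
Proof.
elim: s => [//|I s IH] /= /andP[uI us].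
by apply: allpairs_uniq => //; [exact: IH | move=> [? ?] [? ?] _ _ /= [-> ->]].
Qed.

(* Partitions padded with zeros to a fixed number N of rows are encoded by
   their beads, the exponents la_j + N - 1 - j of the alternant. *)
Fixpoint beads (l : seq nat) : seq nat :=
  if l is a :: l' then (a + size l')%N :: beads l' else [::].

Lemma size_beads l : size (beads l) = size l.
Proof. by elim: l => //= a l ->. Qed.

Lemma nth_beads l j : (j < size l)%N ->
  nth 0%N (beads l) j = (nth 0%N l j + (size l - j.+1))%N.
Proof.
elim: l j => [//|a l IH] [|j] /= jl; first by rewrite subn1.
by rewrite IH // subSS.
Qed.

Fixpoint ranges (l : seq nat) : seq (seq nat) :=
  if l is a :: l' then
    if l' is b :: _ then iota b (a - b).+1 :: ranges l' else [::]
  else [::].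

(** Consecutive rows of a Gelfand-Tsetlin pattern: deleting the largest letter from a semistandard
    tableau of shape l leaves a tableau of such a shape. *)
Definition inter (l : seq nat) : seq (seq nat) := choices (ranges l).

Lemma size_ranges l : size (ranges l) = (size l).-1.
Proof. by elim: l => //= a [//|b l] /= ->. Qed.

Lemma nth_ranges l j : (j.+1 < size l)%N -> nth [::] (ranges l) j =
  iota (nth 0%N l j.+1) (nth 0%N l j - nth 0%N l j.+1).+1.
Proof.
elim: l j => [//|a [//|b l] IH] [//|j] jl.
by rewrite /= in IH jl *; rewrite IH.
Qed.

Lemma sorted_geq_nth l j : sorted geq l -> (nth 0 l j.+1 <= nth 0 l j)%N.
Proof.
move=> ls; case: (ltnP j.+1 (size l)) => jl; last by rewrite nth_default.
exact: (sortedP 0%N ls).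
Qed.

Lemma mem_inter l m : sorted geq l ->
  (m \in inter l) = (size m == (size l).-1) &&
    all (fun j => nth 0 l j.+1 <= nth 0 m j <= nth 0 l j)%N (iota 0 (size l).-1).
Proof.
move=> ls; rewrite /inter (mem_choices 0%N) size_ranges; congr (_ && _).
apply: eq_in_all => j; rewrite mem_iota add0n => /= jl.
rewrite nth_ranges; last by lia.
rewrite mem_iota; have := sorted_geq_nth j ls; lia.
Qed.

Lemma uniq_inter l : uniq (inter l).
Proof.
apply: uniq_choices; elim: l => //= a [//|b l] /= ->.
by rewrite andbT; exact: (iota_uniq b (a - b).+1).
Qed.

Lemma sumn_nth l : sumn l = (\sum_(i < size l) nth 0 l i)%N.
Proof. by rewrite sumnE (big_nth 0%N) big_mkord. Qed.

Section Alternant.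
Variable R : comNzRingType.

(** The entry function g is arbitrary because the generating-function argument puts a polynomial,
    and not only a power of a variable, into each entry. *)
Definition alternant N (g : nat -> nat -> R) (s : seq nat) : R :=
  \det (\matrix_(j < N, i < N) g (nth 0%N s j) i).

Definition pw (x : nat -> R) (e i : nat) : R := x i ^+ e.

(** Subtracting from each row a multiple of the next one clears the column of x_N except in the last
    row. Every entry of the remaining minor is x_i - x_N times a geometric sum, whose terms
    correspond to the values allowed for one part of an interlacing sequence; multilinearity expands
    the minor over these sequences. *)
Lemma alternant_branch N (x : nat -> R) l : size l = N.+1 -> sorted geq l ->
  alternant N.+1 (pw x) (beads l) =
  (\prod_(i < N) (x i - x N)) *
  \sum_(m <- inter l) x N ^+ (sumn l - sumn m) * alternant N (pw x) (beads m).
Proof.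
move=> sl ls; rewrite /alternant.
pose al j := nth 0%N (beads l) j.
have alE j : (j <= N)%N -> al j = (nth 0%N l j + (N - j))%N.
  by move=> jN; rewrite /al nth_beads sl // subSS.
have al_dec j : (j < N)%N -> (al j.+1 < al j)%N.
  move=> jN; rewrite !alE; try lia.
  by have := sorted_geq_nth j ls; lia.
pose M := \matrix_(j < N.+1, i < N.+1) pw x (al j) i.
rewrite -[LHS]/(\det M).
(* Multiplication by the transpose of [T] subtracts from row j the multiple x_N^(al j - al (j+1)) of
   row j + 1. As [T] is unitriangular, the determinant does not change. *)
pose T := \matrix_(i < N.+1, j < N.+1) (if i == j :> nat then 1 else
   if i == j.+1 :> nat then - x N ^+ (al j - al i) else 0) : 'M[R]_N.+1.
have detT : \det T = 1.
  rewrite det_trig; first by rewrite big1 // => i _; rewrite mxE eqxx.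
  apply/is_trig_mxP => i j ij; rewrite mxE; case: ifP => [|_]; first lia.
  by case: ifP => //; lia.
rewrite -[LHS]mul1r -[X in X * _]detT -det_tr -det_mulmx.
set B := _ *m M.
have Blast i : B ord_max i = x i ^+ al N.
  rewrite !mxE (bigD1 ord_max) //= big1 ?addr0; last first.
    move=> k /negPf kN; rewrite !mxE.
    rewrite [_ == _ :> nat]kN; case: eqP => [e|]; last by rewrite mul0r.
    by exfalso; move: e (ltn_ord k) => /= ->; lia.
  by rewrite !mxE eqxx mul1r.
have Bother (j : 'I_N) i : B (lift ord_max j) i =
    x i ^+ al j - x N ^+ (al j - al j.+1) * x i ^+ al j.+1.
  have jN : (j < N.+1)%N by apply: ltnW; have := ltn_ord j.
  have jN1 : (j.+1 < N.+1)%N by have := ltn_ord j.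
  have lj : lift ord_max j = j :> nat by rewrite lift_max.
  rewrite !mxE (bigD1 (Ordinal jN)) //= (bigD1 (Ordinal jN1)) /=; last first.
    by rewrite -val_eqE /=; lia.
  rewrite big1 ?addr0; last first.
    move=> k /andP[/negPf h1 /negPf h2]; rewrite !mxE lj.
    rewrite -val_eqE /= in h1; rewrite -val_eqE /= in h2.
    by rewrite h1 h2 mul0r.
  rewrite !mxE lj /= eqxx mul1r; case: eqP => [|_]; first by lia.
  by rewrite eqxx mulNr.
rewrite (expand_det_col _ ord_max) (bigD1 ord_max) //= big1 ?addr0; last first.
  move=> i; rewrite -val_eqE /= => iN.
  have iN' : (i < N)%N by have := ltn_ord i; lia.
  have -> : i = lift ord_max (Ordinal iN') by apply: ord_inj; rewrite lift_max.
  rewrite Bother /= -exprD subnK ?subrr ?mul0r //.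
  by rewrite ltnW // al_dec.
rewrite Blast /cofactor -signr_odd addnn odd_double expr0 mul1r.
(* [C] is the minor after x_i - x_N has been taken out of column i. The exponent c + (N - j - 1) is
   the bead of a part c in row j among N rows. *)
pose C := \matrix_(j < N, i < N) \sum_(c <- nth [::] (ranges l) j)
   x N ^+ (nth 0%N l j - c) * x i ^+ (c + (N - j.+1)).
have -> : row' ord_max (col' ord_max B) = C *m diag_mx (\row_i (x i - x N)).
  apply/matrixP => j i; rewrite mul_mx_diag !mxE.
  have := Bother j (lift ord_max i); rewrite !mxE /= => ->.
  have jN : (j < N)%N := ltn_ord j.
  have li : bump N i = i by have := lift_max i; rewrite /=.
  rewrite li nth_ranges; last by rewrite sl ltnS.
  set a := nth 0%N l j; set b := nth 0%N l j.+1.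
  have ba : (b <= a)%N by exact: sorted_geq_nth.
  rewrite (alE _ jN) (alE _ (ltnW jN)) -/a -/b.
  rewrite [RHS]mulrC.
  have -> : iota b (a - b).+1 = [seq (b + k)%N | k <- index_iota 0 (a - b).+1].
    by rewrite /index_iota subn0 -iotaDl addn0.
  rewrite big_map.
  have -> : x i ^+ (a + (N - j)) = x i ^+ (a - b).+1 * x i ^+ (b + (N - j.+1)).
    by rewrite -exprD; congr (_ ^+ _); lia.
  have -> : (a + (N - j) - (b + (N - j.+1)) = (a - b).+1)%N by lia.
  rewrite -mulrBl subrXX -mulrA mulr_suml; congr (_ * _).
  rewrite -(big_mkord xpredT (fun k => x i ^+ ((a - b).+1.-1 - k) * x N ^+ k *
    x i ^+ (b + (N - j.+1)))) big_nat_rev /=.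
  apply: eq_big_nat => k kab; rewrite [x i ^+ _ * _]mulrC -mulrA -exprD.
  by congr (_ ^+ _ * _ ^+ _); lia.
rewrite (det_mulmx C) det_diag mulrA mulrC; congr (_ * _).
  by apply: eq_bigr => i _; rewrite mxE.
have -> : \det C = \sum_(s : 'S_N) \sum_(m <- inter l) (-1) ^+ s * \prod_(j < N)
     (x N ^+ (nth 0%N l j - nth 0%N m j) * x (s j) ^+ (nth 0%N m j + (N - j.+1))).
  apply: eq_bigr => s _; rewrite -mulr_sumr; congr (_ * _).
  have szr : size (ranges l) = N by rewrite size_ranges sl.
  (* [prod_sum_choices] wants a family indexed by all natural numbers; the fallback for k >= N is
     never evaluated. *)
  pose F (k c : nat) := (x N ^+ (nth 0%N l k - c) *
    x (if insub k is Some k' then s k' else k) ^+ (c + (N - k.+1)) : R).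
  transitivity (\prod_(j < N) \sum_(c <- nth [::] (ranges l) j) F j c).
    apply: eq_bigr => j _; rewrite mxE; apply: eq_bigr => c _.
    by rewrite /F valK.
  have := prod_sum_choices (ranges l) F; rewrite szr => ->.
  apply: eq_bigr => c _; apply: eq_bigr => j _.
  by rewrite /F valK.
rewrite exchange_big /= mulr_sumr; apply: eq_big_seq => m mi.
have := mi; rewrite mem_inter // sl /= => /andP[/eqP sm /allP hm].
rewrite /determinant mulr_sumr mulr_sumr; apply: eq_bigr => s _.
rewrite big_split /= !mulrA; congr (_ * _); last first.
  by apply: eq_bigr => j _; rewrite mxE /pw nth_beads sm.
rewrite mulrAC; congr (_ * _).
rewrite prodrXr -exprD; congr (_ ^+ _).
rewrite alE // subnn addn0.
rewrite !sumn_nth sl sm big_ord_recr /=.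
have -> : (\sum_(i < N) nth 0 l i =
    \sum_(i < N) (nth 0 l i - nth 0 m i) + \sum_(i < N) nth 0 m i)%N.
  rewrite -big_split /=; apply: eq_bigr => i _.
  have := hm i; rewrite mem_iota /= add0n ltn_ord => /(_ isT); lia.
by rewrite addnAC addnK addnC.
Qed.
End Alternant.

(** * Moving beads *)

Local Open Scope nat_scope.

Lemma sorted_gtn_cons a s : sorted gtn (a :: s) = all (gtn a) s && sorted gtn s.
Proof. by rewrite /= (path_sortedE (fun x y z xy yz => ltn_trans yz xy)). Qed.

Lemma sorted_gtn_split (s : seq nat) (p v : nat) :
  sorted gtn s -> p \in s -> v \notin s -> (p < v)%N ->
  s = [seq b <- s | v < b] ++ [seq b <- s | p < b < v] ++ p :: [seq b <- s | b < p].
Proof.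
move=> + + + pv; elim: s => [//|a s IH]; rewrite sorted_gtn_cons => /andP[/allP sa ss].
rewrite !inE negb_or => ps /andP[va vs].
have nil_gt q : (a <= q)%N -> [seq b <- s | q < b] = [::].
  move=> aq; apply/eqP; rewrite -[_ == _]negbK -has_filter -all_predC.
  by apply/allP => b /sa /=; lia.
case/predU1P: ps => [pa|ps].
  rewrite -pa /= ltnn ltnNge ltnW // nil_gt; last by rewrite -pa ltnW.
  have -> : [seq b <- s | p < b < v] = [::].
    apply/eqP; rewrite -[_ == _]negbK -has_filter -all_predC.
    by apply/allP => b /sa /=; lia.
  by congr (_ :: _); apply/esym/all_filterP/allP => b /sa /=; rewrite pa.
have pa : (p < a)%N by exact: sa.
rewrite /= pa /= [(a < p)%N]ltnNge (ltnW pa) /=.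
case: (ltnP v a) => va'.
  by rewrite (ltnNge a v) (ltnW va') /= -IH.
rewrite nil_gt // [(a < v)%N]ltn_neqAle eq_sym va va' /=; congr (_ :: _).
by rewrite {1}(IH ss ps vs) nil_gt.
Qed.

(** The source v - r is deleted by a filter, which makes the function total; it is a bead move only
    under [can_shift]. *)
Definition shift r v s : seq nat :=
  [seq b <- s | v < b] ++ v :: [seq b <- s | (b < v) && (b + r != v)].

Definition can_shift r v s := has (fun b => b + r == v)%N s && (v \notin s).

Definition jumped r v s : nat := count (fun b => b < v < b + r)%N s.

(** Only the beads strictly between p and p + r change their order relative to the moving bead. They
    form s2, so sorting the rows again costs size s2 transpositions. *)
Lemma shift_split (r p : nat) (s : seq nat) :
  (0 < r)%N -> sorted gtn s -> p \in s -> (p + r)%N \notin s ->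
  exists s1 s2 s3 : seq nat, [/\ s = s1 ++ s2 ++ p :: s3,
    shift r (p + r) s = s1 ++ (p + r)%N :: s2 ++ s3 & jumped r (p + r) s = size s2].
Proof.
move=> r0 ss ps vs; set v := (p + r)%N in vs *.
have pv : (p < v)%N by rewrite /v; lia.
exists [seq b <- s | v < b], [seq b <- s | p < b < v], [seq b <- s | b < p].
split; first exact: sorted_gtn_split.
- congr (_ ++ _ :: _); rewrite {1}(sorted_gtn_split ss ps vs pv) !filter_cat /=.
  rewrite pv /v eqxx /= -!filter_predI -[RHS]cat0s; congr (_ ++ (_ ++ _)).
  + apply/eqP; rewrite -[_ == _]negbK -has_filter -all_predC.
    by apply/allP => b _ /=; lia.
  + by apply: eq_filter => b /=; lia.
  + by apply: eq_filter => b /=; lia.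
- by rewrite size_filter; apply: eq_count => b; rewrite /v; lia.
Qed.

Lemma mem_shift r v s b :
  (b \in shift r v s) = (b == v) || ((b \in s) && (b + r != v)%N && (b != v)).
Proof.
rewrite /shift mem_cat inE !mem_filter.
case: (ltngtP b v) => [bv|bv|->] /=; rewrite ?andbF ?orbF ?andbT //=.
- by rewrite andbC.
- by case: (b \in s) => //=; apply/esym/eqP; lia.
Qed.

Lemma shift_sorted r v s : sorted gtn s -> sorted gtn (shift r v s).
Proof.
have tr : transitive gtn by move=> x y z xy yz; exact: ltn_trans yz xy.
move=> ss; rewrite !(sorted_pairwise tr) /shift pairwise_cat /=.
rewrite !(pairwise_filter) -?(sorted_pairwise tr) // !andbT /=.
apply/andP; split.
  apply/allrelP => a b; rewrite mem_filter inE mem_filter => /andP[va _].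
  by case/predU1P=> [->//|/andP[/andP[bv _] _]] /=; lia.
by apply/allP => b; rewrite mem_filter => /andP[/andP[]].
Qed.

Lemma size_shift r v s : (0 < r)%N -> sorted gtn s -> can_shift r v s ->
  size (shift r v s) = size s.
Proof.
move=> r0 ss /andP[/hasP[p ps /eqP <-] vs].
have [s1 [s2 [s3 [e -> _]]]] := shift_split r0 ss ps vs.
by rewrite [in RHS]e !size_cat /= !size_cat /=; lia.
Qed.

Local Open Scope ring_scope.

Section Alternant.
Variable R : comNzRingType.
Implicit Types g : nat -> nat -> R.

Lemma alternant_swap N g a b s1 s2 : (size s1 + 1 < N)%N ->
  alternant N g (s1 ++ a :: b :: s2) = - alternant N g (s1 ++ b :: a :: s2).
Proof.
move=> sN; have i0N : (size s1 < N)%N by lia.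
pose i0 := Ordinal i0N; pose i1 := Ordinal sN.
have n01 : i0 != i1 by rewrite -val_eqE /=; lia.
rewrite /alternant.
have -> : \matrix_(j < N, i < N) g (nth 0%N (s1 ++ a :: b :: s2) j) i =
  xrow i0 i1 (\matrix_(j < N, i < N) g (nth 0%N (s1 ++ b :: a :: s2) j) i).
  apply/matrixP => j i; rewrite !mxE !nth_cat; case: tpermP => [->|->|/eqP h0 /eqP h1].
  - rewrite /= ltnn subnn /=; case: ltnP => [|_]; first by lia.
    by rewrite addKn.
  - rewrite /= ltnn subnn /=; case: ltnP => [|_]; first by lia.
    by rewrite addKn.
  case: ltnP => // sj; congr (g _ _).
  rewrite -val_eqE /= in h0; rewrite -val_eqE /= in h1.
  by have -> : (j - size s1 = (j - size s1 - 2).+2)%N by lia.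
by rewrite xrowE det_mulmx det_perm odd_tperm n01 expr1 mulN1r.
Qed.

Lemma alternant_move N g v s1 s2 s3 : (size s1 + size s2 < N)%N ->
  alternant N g (s1 ++ s2 ++ v :: s3) =
  (-1) ^+ size s2 * alternant N g (s1 ++ v :: s2 ++ s3).
Proof.
elim: s2 s1 => [|c s2 IH] s1 sN /=; first by rewrite mul1r.
have := IH (rcons s1 c); rewrite !cat_rcons => ->; last first.
  by rewrite size_rcons; rewrite /= in sN; lia.
rewrite alternant_swap; first by rewrite exprS mulrN mulN1r mulNr.
by rewrite /= in sN; lia.
Qed.

Lemma alternant_eq0 N g s (i j : nat) : (i < N)%N -> (j < N)%N -> i != j ->
  nth 0%N s i = nth 0%N s j -> alternant N g s = 0.
Proof.
move=> iN jN ij e.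
apply: (determinant_alternate (i1 := Ordinal iN) (i2 := Ordinal jN)) => //.
by move=> k; rewrite !mxE /= e.
Qed.

Lemma eq_alternant N g1 g2 s : size s = N ->
  (forall e i, e \in s -> (i < N)%N -> g1 e i = g2 e i) ->
  alternant N g1 s = alternant N g2 s.
Proof.
move=> sN h; congr (\det _); apply/matrixP => j i; rewrite !mxE h //.
by rewrite mem_nth // sN.
Qed.

Lemma alternant_scale N g (h : nat -> R) s :
  alternant N (fun e i => g e i * h i) s = alternant N g s * \prod_(i < N) h i.
Proof.
rewrite /alternant; have -> : \matrix_(j < N, i < N) (g (nth 0%N s j) i * h i) =
    (\matrix_(j < N, i < N) g (nth 0%N s j) i) *m diag_mx (\row_i h i).
  by apply/matrixP => j i; rewrite mul_mx_diag !mxE.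
by rewrite det_mulmx det_diag; congr (_ * _); apply: eq_bigr => i _; rewrite mxE.
Qed.

End Alternant.

Lemma alternant_map (R S : comNzRingType) (f : {rmorphism R -> S}) N g s :
  f (alternant N g s) = alternant N (fun e i => f (g e i)) s.
Proof.
rewrite /alternant -det_map_mx; congr (\det _).
by apply/matrixP => j i; rewrite !mxE.
Qed.

(* The sequences of shifts that can be performed from s with strictly increasing
   targets in the half-open interval [v, v + f). *)
Fixpoint targets r f v s : seq (seq nat) :=
  if f is f'.+1 then
    targets r f' v.+1 s ++
    (if can_shift r v s then [seq v :: ts | ts <- targets r f' v.+1 (shift r v s)]
     else [::])
  else [:: [::]].

Definition shifts r s ts := foldl (fun s v => shift r v s) s ts.

Fixpoint jumps r s ts : nat :=
  if ts is v :: ts' then (jumped r v s + jumps r (shift r v s) ts')%N else 0%N.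

Section Recursion.
Variables (R : comNzRingType) (r n : nat) (x : nat -> R).
Hypothesis r0 : (0 < r)%N.

(* The image of the exponent e under all further shifts, with targets at least
   v; 'X marks the number of shifts. *)
Definition remaining v (e i : nat) : {poly R} :=
  \poly_(j < if (e + r < v)%N then 1 else n.+1) x i ^+ (e + r * j).

Lemma remaining_next v e i : (e + r)%N != v -> remaining v e i = remaining v.+1 e i.
Proof. by move=> ev; rewrite /remaining ltnS [in RHS]leq_eqVlt (negPf ev). Qed.

(** A geometric series is its first term plus 'X times the series that starts one step later: the
    bead stays or moves. Truncating both series at degree n leaves a correction in degree n + 1. *)
Lemma remaining_step e i : remaining (e + r) e i =
  remaining (e + r).+1 e i + 'X * remaining (e + r).+1 (e + r) i
   - 'X^(n.+1) * (x i ^+ (e + r * n.+1))%:P.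
Proof.
rewrite /remaining ltnn ltnSn; have -> : (e + r + r < (e + r).+1)%N = false by lia.
rewrite (mulrC 'X); apply/polyP => k; rewrite !(coefD, coefN, coef_poly, coefMX, coefXnM, coefC).
case: k => [|k] /=; first by rewrite subr0 addr0.
rewrite subSS add0r !ltnS.
have -> : (e + r + r * k = e + r * k.+1)%N by lia.
case: (ltngtP k n) => [kn|kn|->] /=; rewrite ?subr0 // ?subn_eq0.
  by rewrite leqNgt kn /= subr0.
by rewrite leqnn subrr.
Qed.

Lemma alternant_step N v s c : size s = N -> sorted gtn s -> (c <= n)%N ->
  (alternant N (remaining v) s)`_c = (alternant N (remaining v.+1) s)`_c +
    if can_shift r v s then (-1) ^+ jumped r v s *
      ('X * alternant N (remaining v.+1) (shift r v s))`_c else 0.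
Proof.
move=> sN ss cn; rewrite /can_shift.
have [|/hasPn no] := boolP (has _ s); last first.
  rewrite addr0 (@eq_alternant _ _ _ (remaining v.+1)) // => e i es iN.
  by apply: remaining_next; exact: no.
case/hasP=> p ps /eqP <-; set v' := (p + r)%N.
have jN : (index p s < N)%N by rewrite -sN index_mem.
pose j0 := Ordinal jN.
have unq j : (j < N)%N -> (nth 0%N s j == p) = (j == index p s).
  move=> jn; rewrite -{1}(nth_index 0%N ps) nth_uniq ?sN //.
  by apply: sorted_uniq ss => [y z t h1 h2|y]; rewrite /= ?ltnn //; exact: ltn_trans h2 h1.
pose s' := set_nth 0%N s (index p s) v'.
(* In [B] the bead p stays. In [C] it has been replaced by v' in place, before the rows are sorted
   again. [D] carries the truncation correction, which the factor 'X^(n.+1) pushes beyond every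
   degree c <= n. *)
pose A := \matrix_(j < N, i < N) remaining v' (nth 0%N s j) i.
pose B := \matrix_(j < N, i < N) remaining v'.+1 (nth 0%N s j) i.
pose C := \matrix_(j < N, i < N) remaining v'.+1 (nth 0%N s' j) i.
pose D := \matrix_(j < N, i < N) if j == j0 then (x i ^+ (p + r * n.+1))%:P
   else remaining v'.+1 (nth 0%N s j) i.
pose E := \matrix_(j < N, i < N) if j == j0 then
     'X * C j i + - 'X^(n.+1) * D j i else B j i.
have lj (j : 'I_N.-1) : (lift j0 j == j0) = false.
  by rewrite eq_sym (negPf (neq_lift _ _)).
have AB : \det A = 1 * \det B + 1 * \det E.
  apply: (determinant_multilinear (i0 := j0)).
  - apply/rowP => i; rewrite !mxE eqxx !mul1r /= !mulNr.
    by rewrite nth_set_nth /= eqxx nth_index // remaining_step -/v' addrA.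
  - apply/matrixP => j i; rewrite !mxE (@remaining_next v') //.
    rewrite eqn_add2r unq //; have := lj j; rewrite -val_eqE /= => -> //.
  - apply/matrixP => j i; rewrite !mxE lj (@remaining_next v') //.
    rewrite eqn_add2r unq //; have := lj j; rewrite -val_eqE /= => -> //.
have EC : \det E = 'X * \det C + - 'X^(n.+1) * \det D.
  apply: (determinant_multilinear (i0 := j0)).
  - by apply/rowP => i; rewrite !mxE eqxx.
  - apply/matrixP => j i; rewrite !mxE lj nth_set_nth /=.
    by have := lj j; rewrite -val_eqE /= => ->.
  - by apply/matrixP => j i; rewrite !mxE lj.
rewrite -[alternant N (remaining v') s]/(\det A) AB !mul1r EC.
rewrite !coefD mulNr coefN coefXnM ltnS cn subr0 -[\det B]/(alternant _ _ _).
congr (_ + _); rewrite -[\det C]/(alternant N (remaining v'.+1) s') /=.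
have v's' : nth 0%N s' (index p s) = v' by rewrite nth_set_nth /= eqxx.
have [vs|vs] := boolP (v' \in s) => /=.
  have ij : index v' s != index p s.
    apply/eqP => h; have := nth_index 0%N vs; rewrite h nth_index // /v'; lia.
  rewrite (@alternant_eq0 _ _ _ _ (index v' s) (index p s)) ?mulr0 ?coef0 //.
    by rewrite -sN index_mem.
  by rewrite v's' nth_set_nth /= (negPf ij) nth_index.
have [s1 [s2 [s3 [e -> ->]]]] := shift_split r0 ss ps vs.
have -> : s' = s1 ++ s2 ++ v' :: s3.
  apply: (@eq_from_nth _ 0%N).
    rewrite size_set_nth; have /maxn_idPr -> : (index p s < size s)%N by rewrite index_mem.
    by rewrite e !size_cat.
  move=> j; rewrite size_set_nth; have /maxn_idPr -> : (index p s < size s)%N by rewrite index_mem.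
  have szp : index p s = (size (s1 ++ s2))%N.
    apply/eqP; rewrite eq_sym -unq; last by rewrite -sN e !size_cat /=; lia.
    by rewrite e catA nth_cat ltnn subnn.
  move=> js; rewrite nth_set_nth /= szp e !catA !nth_cat.
  case: ltngtP => //= [h|->]; last by rewrite subnn.
  by have /prednK <- : (0 < j - size (s1 ++ s2))%N by rewrite subn_gt0.
rewrite alternant_move; last by rewrite -sN e !size_cat /=; lia.
by rewrite mulrCA -polyC1 -polyCN -rmorphXn /= coefCM.
Qed.

(** The bound says that c moves starting from any bead stay below v + f, so the fuel f covers every
    target. When the fuel is exhausted and c is positive, every entry has become constant in 'X and
    the coefficient is zero. *)
Lemma alternant_targets N f v s c : size s = N -> sorted gtn s -> (c <= n)%N ->
  all (fun b => b + r * c < v + f)%N s ->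
  (alternant N (remaining v) s)`_c =
  \sum_(ts <- targets r f v s | size ts == c)
     (-1) ^+ jumps r s ts * alternant N (pw x) (shifts r s ts).
Proof.
elim: f v s c => [|f IH] v s c sN ss cn /allP vs /=.
  have c0 : c != 0%N -> (alternant N (remaining v) s)`_c = 0.
    move=> c0; rewrite (@eq_alternant _ _ _ (fun e i => (pw x e i)%:P)) //.
      by rewrite -(alternant_map polyC) coefC (negPf c0).
    move=> e i es _; apply/polyP => k; rewrite coef_poly coefC.
    have -> : (e + r < v)%N by have := vs e es; nia.
    by case: k => //=; rewrite muln0 addn0.
  case: c cn vs c0 => [|c] cn vs c0.
    rewrite big_cons big_nil /= addr0 mul1r.
    rewrite -horner_coef0 -[LHS]/(horner_eval 0 _) alternant_map.
    apply: eq_alternant => // e i _ _ /=; rewrite horner_evalE horner_coef0 coef_poly.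
    by case: (e + r < v)%N; rewrite /= muln0 addn0.
  by rewrite big_cons big_nil /= c0.
rewrite alternant_step // big_cat /=; congr (_ + _).
  by apply: IH => //; apply/allP => b /vs; rewrite addSnnS.
case: ifP => cs; last by rewrite big_nil.
rewrite big_map /=.
rewrite mulrC coefXM; case: c cn vs => [|c] cn vs /=.
  by rewrite mul0r big_pred0.
rewrite (IH v.+1 (shift r v s) c) ?size_shift ?shift_sorted //; last 2 first.
- exact: ltnW.
- have [/hasP[p ps /eqP pv] _] := andP cs.
  apply/allP => b; rewrite mem_shift => /predU1P[->|].
    by have := vs p ps; rewrite -pv; lia.
  by case/andP=> /andP[/vs]; lia.
rewrite mulr_suml; apply: eq_big => ts; first by rewrite eqSS.
by move=> _; rewrite mulrC mulrA -exprD.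
Qed.

(** Multiplying column i by the truncated series of x_i^r turns x_i^e into [remaining 0], the state
    in which no target has been passed. *)
Lemma alternant_hpower N F s : size s = N -> sorted gtn s ->
  all (fun b => b + r * n < F)%N s ->
  alternant N (pw x) s * (\prod_(i < N) \poly_(j < n.+1) x i ^+ (r * j))`_n =
  \sum_(ts <- targets r F 0 s | size ts == n)
     (-1) ^+ jumps r s ts * alternant N (pw x) (shifts r s ts).
Proof.
move=> sN ss sF; rewrite -alternant_targets // -coefCM (alternant_map polyC).
rewrite -(alternant_scale _ _ (fun i => \poly_(j < n.+1) x i ^+ (r * j))).
rewrite (@eq_alternant _ _ _ (remaining 0)) // => e i _ _ /=.
apply/polyP => k; rewrite coefCM !coef_poly /=; case: ifP => _; last by rewrite mulr0.
by rewrite /pw -exprD.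
Qed.

End Recursion.

(** * Ribbons and beads *)

Local Open Scope nat_scope.

Lemma gtn_trans : transitive gtn.
Proof. by move=> x y z xy yz; exact: ltn_trans yz xy. Qed.

Lemma geq_trans : transitive geq.
Proof. by move=> x y z xy yz; exact: leq_trans yz xy. Qed.

(** * Padded partitions and their beads *)

Definition pad N (la : seq nat) : seq nat := la ++ nseq (N - size la) 0.

Definition config N (la : seq nat) : seq nat := beads (pad N la).

Lemma size_pad N la : size la <= N -> size (pad N la) = N.
Proof. by move=> laN; rewrite size_cat size_nseq subnKC. Qed.

Lemma nth_pad N la t : nth 0 (pad N la) t = nth 0 la t.
Proof. by rewrite nth_cat nth_nseq if_same; case: ltnP => // /(nth_default 0) ->. Qed.

Lemma sumn_pad N la : sumn (pad N la) = sumn la.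
Proof. by rewrite sumn_cat sumn_nseq mul0n addn0. Qed.

Lemma intpart_sorted (la : intpart) : sorted geq la.
Proof. by case/andP: (valP la). Qed.

Lemma intpart_pos (la : intpart) : all (ltn 0) la.
Proof. by case/andP: (valP la). Qed.

Lemma leq_size_sumn (la : intpart) : size la <= sumn la.
Proof. by have := intpart_pos la; elim: (parts la) => //= a l IH /andP[a0 /IH]; lia. Qed.

Lemma sorted_pad N la : sorted geq la -> sorted geq (pad N la).
Proof.
move=> ls; rewrite (sorted_pairwise geq_trans) pairwise_cat.
rewrite -(sorted_pairwise geq_trans) ls /= andbC; apply/andP; split.
  by elim: (N - size la) => //= k ->; rewrite andbT; apply/allP => b /nseqP[->].
by apply/allrelP => a b _ /nseqP[-> _].
Qed.

Lemma sorted_beads l : sorted geq l -> sorted gtn (beads l).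
Proof.
elim: l => [//|a l IH] als; have := subseq_sorted geq_trans (subseq_cons l a) als.
move=> /IH; case: l als {IH} => [//|b l] /= /andP[ab _] ->.
by rewrite andbT; lia.
Qed.

Fixpoint unbeads (s : seq nat) : seq nat :=
  if s is a :: s' then (a - size s') :: unbeads s' else [::].

Lemma size_unbeads s : size (unbeads s) = size s.
Proof. by elim: s => //= a s ->. Qed.

Lemma beadsK l : unbeads (beads l) = l.
Proof. by elim: l => //= a l ->; rewrite size_beads addnK. Qed.

Lemma unbeadsK s : sorted gtn s -> beads (unbeads s) = s.
Proof.
have size_le a s' : path gtn a s' -> size s' <= a.
  elim: s' a => //= b s' IH a /andP[ab /IH]; lia.
elim: s => //= a s IH h; rewrite IH ?(path_sorted h) // size_unbeads subnK //.
exact: size_le.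
Qed.

Lemma sorted_unbeads s : sorted gtn s -> sorted geq (unbeads s).
Proof.
elim: s => //= a [//|b s] IH /andP[ab /IH /= ->].
by rewrite andbT; lia.
Qed.

Lemma part_subproof s : sorted geq s ->
  sorted geq [seq x <- s | 0 < x] && all (ltn 0) [seq x <- s | 0 < x].
Proof. by move=> ss; rewrite (sorted_filter geq_trans) // filter_all. Qed.

(* Junk value (the empty partition) when s is not a strictly decreasing
   sequence. *)
Definition part_of (s : seq nat) : intpart :=
  if decP (@idP (sorted gtn s)) is left h
  then IntPart (part_subproof (sorted_unbeads h))
  else IntPart (parts := [::]) isT.

Lemma pad_filter l : sorted geq l -> pad (size l) [seq x <- l | 0 < x] = l.
Proof.
rewrite /pad; elim: l => [//|a l IH] als.
have := IH (subseq_sorted geq_trans (subseq_cons l a) als).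
case: a als => [|a] als /=; last by rewrite subSS => ->.
suff -> : [seq x <- l | 0 < x] = [::] by rewrite /= !subn0 /= => ->.
apply/eqP; rewrite -[_ == _]negbK -has_filter; apply/hasPn => x xl.
by move: als; rewrite /= (path_sortedE geq_trans) => /andP[/allP/(_ x xl)] /=; lia.
Qed.

Lemma part_ofK s : sorted gtn s -> config (size s) (part_of s) = s.
Proof.
move=> ss; rewrite /part_of; case: decP => [h|]; last by rewrite ss.
rewrite /config /= -[X in pad X _]size_unbeads pad_filter ?unbeadsK //.
exact: sorted_unbeads.
Qed.

Lemma size_part_of s : size (part_of s) <= size s.
Proof.
rewrite /part_of; case: decP => h //=.
by rewrite size_filter -[leqRHS](size_unbeads s) count_size.
Qed.

Lemma configK N (la : intpart) : size la <= N -> part_of (config N la) = la.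
Proof.
move=> laN; rewrite /part_of; case: decP => [h|[]]; last first.
  by rewrite sorted_beads // sorted_pad // intpart_sorted.
apply: val_inj; rewrite /= beadsK filter_cat.
have /all_filterP -> := intpart_pos la.
by elim: (_ - _) => /= [|k]; rewrite ?cats0.
Qed.

Lemma config_sorted N (la : intpart) : sorted gtn (config N la).
Proof. by rewrite sorted_beads // sorted_pad // intpart_sorted. Qed.

Lemma size_config N la : size la <= N -> size (config N la) = N.
Proof. by move=> laN; rewrite size_beads size_pad. Qed.

Lemma nth_config N la t : size la <= N -> t < N ->
  nth 0 (config N la) t = nth 0 la t + (N - t.+1).
Proof. by move=> laN tN; rewrite nth_beads size_pad // nth_pad. Qed.

Lemma sumn_beads l : sumn (beads l) = sumn l + 'C(size l, 2).
Proof. by elim: l => //= a l ->; rewrite binS bin1; lia. Qed.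

Lemma sumn_config N la : size la <= N -> sumn (config N la) = sumn la + 'C(N, 2).
Proof. by move=> laN; rewrite sumn_beads sumn_pad size_pad. Qed.

(** * Diagrams and skew shapes *)

Lemma mem_dg mu a b : ((a, b) \in dg mu) = (0 < a) && (0 < b <= nth 0 mu a.-1).
Proof.
apply/allpairsPdep/idP.
  case=> -[|a'] [b' [ha hb [-> ->]]]; move: ha hb; rewrite !mem_iota //; lia.
case/andP=> a0 /andP[b0 hb]; exists a, b; split=> //; rewrite mem_iota; last by lia.
by case: (ltnP a.-1 (size mu)) => h; [lia | rewrite nth_default // in hb; lia].
Qed.

Lemma dg_uniq mu : uniq (dg mu).
Proof.
apply: allpairs_uniq_dep => [|a _|]; rewrite ?iota_uniq //.
by move=> [a b] [a' b'] _ _ /= [-> ->].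
Qed.

Lemma size_dg mu : size (dg mu) = sumn mu.
Proof.
rewrite size_allpairs_dep; congr sumn.
apply: (@eq_from_nth _ 0); rewrite size_map size_iota // => i ip.
by rewrite (nth_map 0) ?size_iota // nth_iota // add1n size_iota.
Qed.

Lemma mem_skew la mu a b :
  ((a, b) \in skew_shape la mu) = (0 < a) && (nth 0 mu a.-1 < b <= nth 0 la a.-1).
Proof. by rewrite mem_filter !mem_dg; lia. Qed.

Lemma sub_dgP (la mu : intpart) :
  reflect (forall t, nth 0 mu t <= nth 0 la t) (all (mem (dg la)) (dg mu)).
Proof.
apply: (iffP allP) => h => [t|[a b]]; last first.
  by rewrite inE !mem_dg => /andP[a0 /andP[b0 bm]]; rewrite a0 b0 (leq_trans bm).
case: (posnP (nth 0 mu t)) => [->//|m0].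
by have := h (t.+1, nth 0 mu t); rewrite inE !mem_dg /= m0 leqnn => /(_ isT).
Qed.

Lemma size_skew (la mu : intpart) : all (mem (dg la)) (dg mu) ->
  size (skew_shape la mu) + sumn mu = sumn la.
Proof.
move=> sub; rewrite -!size_dg /skew_shape size_filter -(count_predC (mem (dg mu)) (dg la)).
rewrite [RHS]addnC; congr (_ + _); rewrite -size_filter.
apply: perm_size; apply: uniq_perm; rewrite ?filter_uniq ?dg_uniq // => b.
by rewrite mem_filter /=; case: (boolP (b \in dg mu)) => // /(allP sub).
Qed.

(** Converse of [shift_split]: the two sortedness hypotheses force s1 above p + r, s2 strictly
    between p and p + r, and s3 below p, so the filters in [shift] find this decomposition. *)
Lemma shift_intro r s1 s2 s3 p : 0 < r ->
  sorted gtn (s1 ++ s2 ++ p :: s3) -> sorted gtn (s1 ++ (p + r) :: s2 ++ s3) ->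
  let s := s1 ++ s2 ++ p :: s3 in let v := p + r in
  [/\ can_shift r v s, shift r v s = s1 ++ v :: s2 ++ s3, jumped r v s = size s2 &
      count (ltn v) s = size s1].
Proof.
move=> r0 ss ss'; set v := p + r; set s := s1 ++ s2 ++ _.
move: (ss); rewrite (sorted_pairwise gtn_trans) pairwise_cat => /and3P[/allrelP A1 _].
rewrite pairwise_cat => /and3P[/allrelP A2 _ /andP[/allP A3 _]].
move: (ss'); rewrite (sorted_pairwise gtn_trans) pairwise_cat => /and3P[/allrelP B1 _].
move=> /andP[/allP B2 _].
have h1 b : b \in s1 -> v < b by move=> bs; apply: B1; rewrite ?inE ?eqxx.
have h2 b : b \in s2 -> p < b < v.
  move=> bs; apply/andP; split; first by apply: A2; rewrite ?inE ?eqxx.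
  by apply: B2; rewrite mem_cat bs.
have h3 b : b \in s3 -> b < p by move=> bs; apply: A3.
have fT (P : pred nat) (t : seq nat) : {in t, forall b, P b} -> [seq b <- t | P b] = t.
  by move=> h; apply/all_filterP/allP.
have fF (P : pred nat) (t : seq nat) : {in t, forall b, ~~ P b} -> [seq b <- t | P b] = [::].
  move=> h; apply/eqP; rewrite -[_ == _]negbK -has_filter; apply/hasPn; exact: h.
have gtv : [seq b <- s | v < b] = s1.
  rewrite /s !filter_cat /= (fT _ s1) // (fF _ s2) ?(fF _ s3) /=; first last.
  - by move=> b /h2; lia.
  - by move=> b /h3; rewrite /v; lia.
  by rewrite ltnNge leq_addr cats0.
split.
- apply/andP; split; first by apply/hasP; exists p; rewrite // /s !mem_cat inE eqxx !orbT.
  rewrite /s !mem_cat inE; apply/negP => /or4P[/h1|/h2|/eqP|/h3]; rewrite /v; lia.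
- rewrite /shift gtv; congr (_ ++ _ :: _).
  rewrite /s !filter_cat /= /v eqxx andbF (fF _ s1) ?(fT _ s2) ?(fT _ s3) //;
    move=> b; first [move=> /h1 | move=> /h2 | move=> /h3]; rewrite /v; lia.
- rewrite /jumped /s !count_cat /=.
  rewrite ltnn andbF -!size_filter (fF _ s1) ?(fT _ s2) ?(fF _ s3) /= ?addn0 //;
    move=> b; first [move=> /h1 | move=> /h2 | move=> /h3]; rewrite /v; lia.
- by rewrite -size_filter gtv.
Qed.

(** * Ribbons as paths of boxes *)

Section RibbonPath.
Variable q : seq (nat * nat).
Hypothesis qs : sorted ribbon_step q.
Local Notation f := (nth (0, 0) q).

Lemma ribbon_path_nth (b : nat * nat) : b \in q -> exists2 k, k < size q & f k = b.
Proof. by move/nthP => /(_ (0, 0)). Qed.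

Lemma ribbon_path_step k : k.+1 < size q ->
  (f k.+1).1 = (f k).1 /\ (f k.+1).2.+1 = (f k).2 \/
  (f k.+1).1 = (f k).1.+1 /\ (f k.+1).2 = (f k).2.
Proof.
move=> kq; have := sortedP (0, 0) qs k kq; rewrite /ribbon_step.
by case/orP=> /andP[/eqP -> /eqP ->]; [left | right].
Qed.

(** Each step left or down lowers the content, column minus row, by one. Hence a ribbon has at most
    one box on each diagonal and contains no 2 x 2 square. *)
Lemma ribbon_path_content k : k < size q ->
  (f k).1 + (f 0).2 = (f 0).1 + (f k).2 + k.
Proof.
elim: k => [|k IH] kq; first by rewrite addn0.
by have := IH (ltnW kq); have := ribbon_path_step kq; lia.
Qed.

Lemma ribbon_path_row k k' : k <= k' < size q -> (f k).1 <= (f k').1.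
Proof.
elim: k' => [|k' IH] /andP[kk' kq]; first by move: kk'; rewrite leqn0 => /eqP ->.
have := ribbon_path_step kq; move: kk'; rewrite leq_eqVlt ltnS => /predU1P[->//|kk'].
have /IH : k <= k' < size q by rewrite kk' ltnW.
lia.
Qed.

Lemma ribbon_path_mem_row k a : k < size q -> (f 0).1 <= a <= (f k).1 ->
  exists2 b : nat * nat, b \in q & b.1 = a.
Proof.
elim: k => [|k IH] kq ha; first by exists (f 0); [exact: mem_nth | apply/eqP; rewrite eqn_leq].
have [e|ne] := eqVneq (f k.+1).1 a; first by exists (f k.+1); first exact: mem_nth.
by apply: IH (ltnW kq) _; have := ribbon_path_step kq; lia.
Qed.

Lemma ribbon_path_inj (b b' : nat * nat) : b \in q -> b' \in q -> b.1 + b'.2 = b'.1 + b.2 -> b = b'.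
Proof.
move=> /ribbon_path_nth[k kq <-] /ribbon_path_nth[k' kq' <-] e.
congr (f _); have := ribbon_path_content kq; have := ribbon_path_content kq'; lia.
Qed.

End RibbonPath.

(** The last clause says that consecutive rows of the ribbon overlap in exactly one column. In terms
    of beads, bead t of mu reappears as bead t + 1 of la, so a single bead has jumped over the
    others. *)
Lemma ribbon_rows r (la mu : intpart) : 0 < r -> is_ribbon r la mu ->
  let l : nat -> nat := nth 0 la in let m : nat -> nat := nth 0 mu in
  exists i j, [/\ i <= j < size la, m i < l i,
    forall t, (t < i) || (j < t) -> l t = m t &
    forall t, i <= t < j -> l t.+1 = (m t).+1].
Proof.
move=> r0 /and3P[/sub_dgP sub /eqP szr /hasP[q]].
rewrite mem_permutations => pq qs l m.
have memq (b : nat * nat) : (b \in q) = (0 < b.1) && (m b.1.-1 < b.2 <= l b.1.-1).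
  by case: b => a b; rewrite (perm_mem pq) mem_skew.
have q0 : 0 < size q by rewrite (perm_size pq) szr.
pose f := nth (0, 0) q; pose z := (size q).-1.
have zq : z < size q by rewrite /z; lia.
have f0 : f 0 \in q by exact: mem_nth.
have fz : f z \in q by exact: mem_nth.
have rows (b : nat * nat) : b \in q -> (f 0).1 <= b.1 <= (f z).1.
  case/ribbon_path_nth => k kq <-; apply/andP; split.
    by apply: (ribbon_path_row qs).
  by apply: (ribbon_path_row qs); rewrite zq andbT -ltnS prednK.
have f00 : 0 < (f 0).1 by move: f0; rewrite memq => /andP[].
have lmt t : (t < (f 0).1.-1) || ((f z).1.-1 < t) -> l t = m t.
  move=> ht; apply/eqP; rewrite eqn_leq sub andbT leqNgt; apply/negP => mlt.
  by have := rows (t.+1, l t); rewrite memq /= mlt leqnn => /(_ isT); lia.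
exists (f 0).1.-1, (f z).1.-1; split=> //.
- have := rows _ f0 => /andP[_ h]; apply/andP; split; first by lia.
  rewrite ltnNge; apply/negP => sz; move: fz; rewrite memq /l nth_default //; lia.
- by move: f0; rewrite memq => /andP[_]; lia.
move=> t ht.
have [] := @ribbon_path_mem_row q qs z t.+2 zq; first by rewrite -/f; lia.
move=> [a b]; rewrite memq /= => hb e; move: hb; rewrite {a}e /= => hb.
(* The last box of its row can only be entered from above, since the box to its right is not in
   la. *)
have : (t.+2, l t.+1) \in q by rewrite memq /= leqnn; lia.
move=> tq; have [[|k] kq fk] := ribbon_path_nth tq.
  by move: ht; rewrite /f fk /=; lia.
have : f k \in q by apply: mem_nth; exact: ltnW.
rewrite memq; have := ribbon_path_step qs kq; rewrite fk -/f /=.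
case=> [[<- <-] /=|[[<-] <-] /=]; first by rewrite -/l; lia.
move=> /andP[mlt _]; apply/eqP; rewrite eqn_leq; apply/andP; split; last by lia.
rewrite leqNgt; apply/negP => lt.
have lt' : l t.+1 <= l t by exact/sorted_geq_nth/intpart_sorted.
(* An overlap of two or more columns would put a second box of the same diagonal into the ribbon. *)
have tq' : (t.+1, (l t.+1).-1) \in q by rewrite memq /=; lia.
by have [] : (t.+2, l t.+1) = (t.+1, (l t.+1).-1);
  [apply: (ribbon_path_inj qs tq tq') => /=; lia | lia].
Qed.

Lemma ribbon_sumn r (la mu : intpart) : is_ribbon r la mu -> sumn la = sumn mu + r.
Proof.
by case/and3P=> sub /eqP <- _; have := size_skew sub; rewrite addnC.
Qed.

Lemma ribbon_shift N r (la mu : intpart) : 0 < r -> size la <= N -> size mu <= N ->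
  is_ribbon r la mu -> exists2 v, can_shift r v (config N mu) &
    config N la = shift r v (config N mu).
Proof.
move=> r0 laN muN rib; have [i [j [hij mli out ins]]] := ribbon_rows r0 rib.
have jN : j < N by lia.
set s := config N mu.
(* [v] is the bead of la in the top row of the ribbon, [p] the bead of mu in its bottom row. *)
pose v := nth 0 la i + (N - i.+1); pose p := nth 0 mu j + (N - j.+1).
pose s1 := take i s; pose s2 := drop i (take j s); pose s3 := drop j.+1 s.
have szs : size s = N by exact: size_config.
have es : s = s1 ++ s2 ++ p :: s3.
  rewrite catA /s1 /s2; have -> : take i s = take i (take j s) by rewrite take_takel //; lia.
  rewrite cat_take_drop /s3 /p -nth_config // -drop_nth ?szs //.
  by rewrite cat_take_drop.
have sz1 : size s1 = i by rewrite size_takel // szs; lia.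
have sz2 : size s2 = j - i by rewrite size_drop size_takel // szs ltnW.
have sz3 : size s3 = N - j.+1 by rewrite size_drop szs.
have el : config N la = s1 ++ v :: s2 ++ s3.
  apply: (@eq_from_nth _ 0) => [|t].
    by rewrite size_config // !size_cat /= size_cat sz1 sz2 sz3; lia.
  rewrite size_config // => tN; rewrite nth_config //.
  rewrite nth_cat sz1; case: ltnP => ti.
    by rewrite nth_take // nth_config // out ?ti.
  have [<-|ne] := eqVneq i t; first by rewrite subnn.
  have -> : t - i = (t - i.+1).+1 by lia.
  rewrite /= nth_cat sz2; case: ltnP => tj.
    rewrite nth_drop; have -> : i + (t - i.+1) = t.-1 by lia.
    rewrite nth_take; last by lia.
    rewrite nth_config //; last by lia.
    have := ins t.-1; have -> : t.-1.+1 = t by lia.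
    by move=> ->; lia.
  rewrite nth_drop; have -> : j.+1 + (t - i.+1 - (j - i)) = t by lia.
  by rewrite nth_config // out //; apply/orP; right; lia.
(* A single bead has changed, and the sums of the two bead sequences differ by the number r of added
   boxes. *)
have vp : v = p + r.
  have := sumn_config laN; have := sumn_config muN; rewrite el -/s es.
  rewrite !sumn_cat /= !sumn_cat /= (ribbon_sumn rib); lia.
have := config_sorted N mu; have := config_sorted N la.
rewrite el -/s es vp => h1 h2.
by have [h3 h4 _ _] := shift_intro r0 h2 h1; exists (p + r); rewrite ?h4.
Qed.


Section Rows.
Variables l m : nat -> nat.

(** Right to left within a row, and rows from top to bottom, is the order in which a ribbon is
    labelled. *)
Definition rev_row t : seq (nat * nat) := rev [seq (t.+1, b) | b <- iota (m t).+1 (l t - m t)].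

Fixpoint rev_rows t k : seq (nat * nat) :=
  if k is k'.+1 then rev_row t ++ rev_rows t.+1 k' else [::].

Lemma mem_rev_rows t k (b : nat * nat) : (b \in rev_rows t k) =
  (t < b.1 <= t + k) && (m b.1.-1 < b.2 <= l b.1.-1).
Proof.
elim: k t => [|k IH] t /=; first by rewrite in_nil; lia.
rewrite mem_cat {}IH mem_rev; case: b => x y /=.
have -> : ((x, y) \in [seq (t.+1, b) | b <- iota (m t).+1 (l t - m t)]) =
    (x == t.+1) && (m t < y <= l t).
  apply/mapP/idP => [[z]|/andP[/eqP -> h]]; last by exists y; rewrite // mem_iota; lia.
  by rewrite mem_iota => h [-> ->]; rewrite eqxx /=; lia.
by have [->|ne] := eqVneq x t.+1; rewrite /= ?ltnn; lia.
Qed.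

Lemma rev_rows_uniq t k : uniq (rev_rows t k).
Proof.
elim: k t => [//|k IH] t /=; rewrite cat_uniq IH andbT rev_uniq map_inj_uniq ?iota_uniq /=.
  apply/hasPn => b; rewrite mem_rev_rows mem_rev => hb.
  by apply/negP => /mapP[z _ bE]; rewrite bE /= ltnn in hb.
by move=> y z [].
Qed.

Lemma rev_row_path t d c (b : nat * nat) : ribbon_step b (t, c.+1 + d) ->
  path ribbon_step b (rev [seq (t, y) | y <- iota c.+1 d.+1]) /\
  last b (rev [seq (t, y) | y <- iota c.+1 d.+1]) = (t, c.+1).
Proof.
elim: d b => [|d IH] b; first by rewrite addn0 /= => ->.
move=> h; rewrite -[d.+2]addn1 iotaD map_cat rev_cat /= h; apply: IH.
by rewrite /ribbon_step /=; apply/orP; left; rewrite eqxx addnS /=.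
Qed.

Lemma rev_rows_path t k (b : nat * nat) : ribbon_step b (t.+1, l t) ->
  (forall u, t <= u < t + k -> m u < l u) ->
  (forall u, t <= u -> u.+1 < t + k -> l u.+1 = (m u).+1) ->
  path ribbon_step b (rev_rows t k).
Proof.
elim: k t b => [//|k IH] t b hb hl hm /=.
have mlt : m t < l t by apply: hl; lia.
rewrite cat_path /rev_row; have -> : l t - m t = (l t - (m t).+1).+1 by lia.
have [|-> ->] := @rev_row_path t.+1 (l t - (m t).+1) (m t) b; first by rewrite subnKC.
case: k IH hl hm => [//|k] IH hl hm.
apply: IH => [|u hu|u hu hu'].
- by rewrite /ribbon_step hm //= ?eqxx ?orbT //; lia.
- by apply: hl; lia.
- by apply: hm; lia.
Qed.

End Rows.

Lemma shift_ribbon N r v (la mu : intpart) : 0 < r -> size la <= N -> size mu <= N ->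
  can_shift r v (config N mu) -> config N la = shift r v (config N mu) ->
  [/\ is_ribbon r la mu, ribbon_sgn la mu = ((-1) ^+ jumped r v (config N mu))%R &
      ribbon_top la mu = (count (ltn v) (config N mu)).+1].
Proof.
move=> r0 laN muN cs ela; have := cs => /andP[/hasP[p ps /eqP pv] vs].
rewrite -{}pv in vs ela cs *; set s := config N mu in ps vs ela cs *.
have ss : sorted gtn s by exact: config_sorted.
have ssl : sorted gtn (config N la) by exact: config_sorted.
have [s1 [s2 [s3 [es esh ejmp]]]] := shift_split r0 ss ps vs.
rewrite ejmp; move: ela; rewrite esh => ela.
have ss' : sorted gtn (s1 ++ s2 ++ p :: s3) by rewrite -es.
have ssl' : sorted gtn (s1 ++ (p + r) :: s2 ++ s3) by rewrite -ela.
have [_ _ _] := shift_intro r0 ss' ssl'; rewrite -es => ->.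
pose i := size s1; pose j := i + size s2.
have szs : size s = N by exact: size_config.
have jN : j < N by rewrite -szs es !size_cat /= /j /i; lia.
pose l : nat -> nat := nth 0 la; pose m : nat -> nat := nth 0 mu.
have cl t : t < N -> nth 0 (config N la) t = l t + (N - t.+1) by exact: nth_config.
have cm t : t < N -> nth 0 s t = m t + (N - t.+1) by exact: nth_config.
have out t : (t < i) || (j < t) -> l t = m t.
  case: (ltnP t N) => tN ht; last by rewrite /l /m !nth_default //; lia.
  suff : nth 0 (config N la) t = nth 0 s t by rewrite cl // cm //; lia.
  rewrite ela es !nth_cat; case: ltnP => // ti.
  rewrite ltnNge ti /= in ht.
  rewrite ltnNge; have -> /= : size s2 <= t - size s1 by rewrite /j /i in ht; lia.
  rewrite -cat_cons nth_cat /= ltnNge.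
  have -> /= : (size s2).+1 <= t - size s1 by rewrite /j /i in ht; lia.
  have -> : t - size s1 - size s2 = (t - size s1 - (size s2).+1).+1 by rewrite /j /i in ht; lia.
  by [].
have ins t : i <= t < j -> l t.+1 = (m t).+1.
  move=> ht; suff : nth 0 (config N la) t.+1 = nth 0 s t by rewrite cl ?cm; lia.
  rewrite ela es !nth_cat ltnNge; have -> /= : size s1 <= t.+1 by rewrite /i in ht; lia.
  rewrite ltnNge; have -> /= : size s1 <= t by rewrite /i in ht; lia.
  have -> : t.+1 - size s1 = (t - size s1).+1 by rewrite /i in ht; lia.
  by rewrite /= !nth_cat; have -> : t - size s1 < size s2 by rewrite /j /i in ht; lia.
have ll t : l t.+1 <= l t by exact/sorted_geq_nth/intpart_sorted.
have mm t : m t.+1 <= m t by exact/sorted_geq_nth/intpart_sorted.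
have sumE : sumn la = sumn mu + r.
  have := sumn_config laN; have := sumn_config muN; rewrite ela -/s es.
  by rewrite !sumn_cat /= !sumn_cat /=; lia.
have mli : m i < l i.
  have [ij|] := ltnP i j.
    by have := ins i; rewrite leqnn ij => /(_ isT); have := ll i; lia.
  rewrite leq_eqVlt ltnNge leq_addr orbF => /eqP ji.
  have s20 : size s2 = 0 by rewrite /j in ji; lia.
  have iN : i < N by rewrite -ji.
  have := cl i iN; have := cm i iN; rewrite ela es !nth_cat -/i ltnn subnn /= s20 /=.
  by lia.
have mlt t : i <= t <= j -> m t < l t.
  case/andP; rewrite leq_eqVlt => /predU1P[<-//|].
  by case: t => // t it tj; rewrite ins ?it //; have := mm t; lia.
have sub : all (mem (dg la)) (dg mu).
  apply/sub_dgP => t; case: (boolP (i <= t <= j)) => [/mlt/ltnW//|h].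
  by rewrite -/(l t) -/(m t) out //; lia.
have memk (b : nat * nat) : (b \in skew_shape la mu) = (b \in rev_rows l m i (j - i).+1).
  case: b => x y; rewrite mem_rev_rows mem_skew -/l -/m /=.
  case: x => [|x]; rewrite /= ?ltn0 //.
  case: (boolP (i < x.+1 <= i + (j - i).+1)) => //= h.
  have xo : (x < i) || (j < x) by rewrite /j in h *; lia.
  by rewrite out //; lia.
have uk : uniq (skew_shape la mu) by rewrite filter_uniq ?dg_uniq.
have mrow (x : nat) : (x \in [seq b.1 | b <- skew_shape la mu]) = (x \in iota i.+1 (j - i).+1).
  apply/mapP/idP => [[[a b]]|].
    by rewrite memk mem_rev_rows mem_iota /= => /andP[h _] ->; lia.
  rewrite mem_iota => h; exists (x, l x.-1) => //.
  have hx : i <= x.-1 <= j by rewrite /j in h *; lia.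
  by rewrite memk mem_rev_rows /= leqnn mlt // !andbT; lia.
split.
- apply/and3P; split=> //.
    by have := size_skew sub; rewrite sumE addnC => /addnI ->.
  apply/hasP; exists (rev_rows l m i (j - i).+1).
    rewrite mem_permutations; by apply: uniq_perm => //; exact: rev_rows_uniq.
  (* A fictitious box to the right of the first one starts the path, so that the top row is treated
     like the others. *)
  apply: (path_sorted (x := (i.+1, (l i).+1))).
  apply: rev_rows_path => [|u hu|u hu hu'].
  + by rewrite /ribbon_step /= !eqxx.
  + by apply: mlt; rewrite /j in hu *; lia.
  + by apply: ins; rewrite /j in hu' *; lia.
- rewrite /ribbon_sgn; congr (_ ^+ _)%R.
  have -> : size (undup [seq b.1 | b <- skew_shape la mu]) = size (iota i.+1 (j - i).+1).
    apply/perm_size/uniq_perm; rewrite ?undup_uniq ?iota_uniq // => x.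
    by rewrite mem_undup mrow.
  by rewrite size_iota /j addKn.
- rewrite /ribbon_top; set rs := sort leq _.
  have mrs (x : nat) : (x \in rs) = (i < x <= j.+1).
    by rewrite mem_sort mrow mem_iota /j; lia.
  have : sorted leq rs by apply: sort_sorted; exact: leq_total.
  have : i.+1 \in rs by rewrite mrs /j; lia.
  case: rs mrs => // h rs mrs; rewrite inE => /predU1P[//|irs] /=.
  rewrite (path_sortedE leq_trans) => /andP[/allP/(_ _ irs) hi _].
  by have := mrs h; rewrite inE eqxx /=; lia.
Qed.

(** * Polyribbons and sequences of bead moves *)

Fixpoint valid_targets r (s : seq nat) (ts : seq nat) : bool :=
  if ts is v :: ts' then can_shift r v s && valid_targets r (shift r v s) ts' else true.

Lemma mem_targets r f v (s ts : seq nat) : (ts \in targets r f v s) =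
  [&& valid_targets r s ts, sorted ltn ts & all (fun w => v <= w < v + f) ts].
Proof.
elim: f v s ts => [|f IH] v s ts /=.
  case: ts => [//|w ts]; rewrite inE /=; apply/esym/negbTE.
  by rewrite addn0; case: ltngtP; rewrite ?andbF.
have bE (w : nat) : v.+1 <= w < v.+1 + f -> v <= w < v + f.+1 by lia.
rewrite mem_cat IH; apply/orP/idP => [[/and3P[-> -> h]|]|/and3P[vt st bt]].
- by apply: sub_all h => w /bE.
- case: ifP => // cs /mapP[ts' + ->]; rewrite IH => /and3P[vt st bt] /=.
  rewrite cs vt leqnn -addSnnS ltn_addr //= (path_sortedE ltn_trans) st andbT.
  by apply/andP; split; apply: sub_all bt => w; lia.
case: ts vt st bt => [|w ts] /=; first by left.
move=> /andP[cs vt]; rewrite (path_sortedE ltn_trans) => /andP[/allP lw st] /andP[bw /allP bt].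
have [e|ne] := eqVneq w v; last first.
  left; rewrite cs vt st /= andbT; apply/and3P; split; [exact/allP | lia |].
  by apply/allP => z zt; have := bt z zt; have /= := lw z zt; lia.
right; rewrite -e cs; apply/mapP; exists ts => //; rewrite IH vt st /=.
by apply/allP => z zt; have := bt z zt; have /= := lw z zt; lia.
Qed.

Lemma uniq_targets r f v (s : seq nat) : uniq (targets r f v s).
Proof.
elim: f v s => [//|f IH] v s /=; rewrite cat_uniq IH /=.
case: ifP => // cs; rewrite map_inj_uniq ?IH ?andbT; last by move=> ? ? [].
apply/hasPn => ? /mapP[ts _ ->]; rewrite mem_targets /= ltnn andbF /=.
by rewrite !andbF.
Qed.

Lemma mem_shifts r (s ts : seq nat) (b : nat) :
  b + r \notin ts -> b \notin ts -> (b \in shifts r s ts) = (b \in s).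
Proof.
elim: ts s => [//|v ts IH] s; rewrite !inE !negb_or => /andP[bv bts] /andP[bv' bts'].
by rewrite /= IH // mem_shift (negPf bv') bv /= !andbT.
Qed.

Lemma mem_shifts_in r (s ts : seq nat) (b : nat) :
  b + r \notin ts -> b \in s -> b \in shifts r s ts.
Proof.
elim: ts s => [//|v ts IH] s; rewrite !inE !negb_or => /andP[bv bts] bs.
by apply: IH => //; rewrite mem_shift bs bv /=; case: eqP.
Qed.

Lemma targets_inj r (s ts ts' : seq nat) : 0 < r ->
  valid_targets r s ts -> sorted ltn ts -> valid_targets r s ts' -> sorted ltn ts' ->
  shifts r s ts = shifts r s ts' -> ts = ts'.
Proof.
move=> r0; have main (u t t' : seq nat) (v : nat) :
    valid_targets r u (v :: t) -> sorted ltn (v :: t) -> v \notin t' ->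
    valid_targets r u t' -> all (ltn v) t' -> shifts r u (v :: t) <> shifts r u t'.
  move=> /= /andP[/andP[/hasP[p pu /eqP pv] _] _].
  rewrite (path_sortedE ltn_trans) => /andP[/allP vt _] vt' _ _ e.
  have : p \in shifts r u t' by apply: mem_shifts_in; rewrite ?pv.
  rewrite -e /= mem_shifts; last 2 first.
  - by apply/negP => /vt /=; rewrite pv ltnn.
  - by apply/negP => /vt /=; lia.
  by rewrite mem_shift pv eqxx andbF /= orbF; lia.
elim: ts s ts' => [|v ts IH] s [|v' ts'] //.
- by move=> _ _ h1 h2 /esym /(main s ts' [::] v' h1 h2 isT isT isT).
- by move=> h1 h2 _ _ /(main s ts [::] v h1 h2 isT isT isT).
move=> h1 h2 h1' h2' e.
have sub (w w' : nat) t : w < w' -> sorted ltn (w' :: t) -> all (ltn w) (w' :: t).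
  move=> ww' /=; rewrite (path_sortedE ltn_trans) ww' => /andP[h _].
  by apply: sub_all h => z /= /(ltn_trans ww').
have notin (w : nat) t : all (ltn w) t -> w \notin t.
  by move=> /allP h; apply/negP => /h /=; rewrite ltnn.
case: (ltngtP v v') => vv'.
- by have a := sub _ _ _ vv' h2'; case: (main s ts (v' :: ts') v h1 h2 (notin _ _ a) h1' a e).
- have a := sub _ _ _ vv' h2.
  by case: (main s ts' (v :: ts) v' h1' h2' (notin _ _ a) h1 a (esym e)).
rewrite -vv' in h1' h2' e *; congr (_ :: _).
move: h1 h1' => /= /andP[_ h1] /andP[_ h1'].
by apply: IH (path_sorted h2) h1' (path_sorted h2') e.
Qed.

Fixpoint trace r (s : seq nat) (ts : seq nat) : seq (seq nat) :=
  if ts is v :: ts' then shift r v s :: trace r (shift r v s) ts' else [::].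

Lemma last_trace r (s ts : seq nat) : last s (trace r s ts) = shifts r s ts.
Proof. by elim: ts s => //= v ts IH s; rewrite IH. Qed.

Lemma size_trace r (s ts : seq nat) : size (trace r s ts) = size ts.
Proof. by elim: ts s => //= v ts IH s; rewrite IH. Qed.

(** A move to v does not change the beads above v. If v' < v, the bead v is counted above v' but not
    above v; v' = v is excluded because v is now occupied. This is the equivalence between weakly
    decreasing tops and strictly increasing targets. *)
Lemma count_shift r (v v' : nat) (s : seq nat) : 0 < r -> sorted gtn s ->
  can_shift r v s -> can_shift r v' (shift r v s) ->
  (count (ltn v') (shift r v s) <= count (ltn v) s) = (v < v').
Proof.
move=> r0 ss cs /andP[_ v's].
have vs : v \in shift r v s by rewrite mem_shift eqxx.
have -> : count (ltn v) s = count (ltn v) (shift r v s).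
  rewrite -!size_filter; apply/perm_size/uniq_perm; try apply: filter_uniq.
  - by apply: (sorted_uniq gtn_trans) => // x; rewrite /= ltnn.
  - by apply: (sorted_uniq gtn_trans (leT := gtn)) (shift_sorted _ _ ss) => x; rewrite /= ltnn.
  move=> b; rewrite !mem_filter mem_shift /=; case: (ltnP v b) => //= vb.
  have -> : (b == v) = false by lia.
  have -> : b + r != v by lia.
  by rewrite !andbT.
apply/idP/idP => [|vv']; last by apply: sub_count => b /= h; exact: ltn_trans h.
apply: contraLR; rewrite -leqNgt -ltnNge leq_eqVlt => /predU1P[e|vv'].
  by rewrite e vs in v's.
rewrite -[ltnRHS]size_filter -(count_predC (ltn v)) !count_filter.
have -> : count (predI (ltn v) (ltn v')) (shift r v s) = count (ltn v) (shift r v s).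
  by apply: eq_count => b /=; lia.
rewrite -addn1 leq_add2l -has_count; apply/hasP; exists v => //=.
by rewrite ltnn.
Qed.

Lemma valid_chain N r (s ts : seq nat) : 0 < r -> size s = N -> sorted gtn s ->
  valid_targets r s ts ->
  let gs := [seq part_of s' | s' <- trace r s ts] in
  [/\ path (fun g g' => is_ribbon r g' g) (part_of s) gs,
      last (part_of s) gs = part_of (shifts r s ts),
      sorted geq (pairmap (fun g g' => ribbon_top g' g) (part_of s) gs) = sorted ltn ts &
      (\prod_(e <- pairmap (fun g g' => ribbon_sgn g' g) (part_of s) gs) e
         = (-1) ^+ jumps r s ts :> rat)%R].
Proof.
move=> r0 sN ss vt gs; rewrite last_map last_trace {}/gs.
have step s1 v : size s1 = N -> sorted gtn s1 -> can_shift r v s1 ->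
    [/\ is_ribbon r (part_of (shift r v s1)) (part_of s1),
     ribbon_sgn (part_of (shift r v s1)) (part_of s1) = ((-1) ^+ jumped r v s1)%R,
     ribbon_top (part_of (shift r v s1)) (part_of s1) = (count (ltn v) s1).+1,
     size (shift r v s1) = N & sorted gtn (shift r v s1)].
  move=> s1N ss1 cs.
  have szs := size_shift r0 ss1 cs; have srt := shift_sorted r v ss1.
  have e1 := part_ofK ss1; have e2 := part_ofK srt; rewrite szs in e2.
  have [] := @shift_ribbon N r v (part_of (shift r v s1)) (part_of s1) r0.
  - by rewrite -s1N -szs size_part_of.
  - by rewrite -s1N size_part_of.
  - by rewrite -s1N e1.
  - by rewrite -s1N e1 e2.
  by rewrite -s1N e1; split.
elim: ts s sN ss vt => [|v ts IH] s sN ss /=; first by rewrite big_nil.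
move=> /andP[cs vt]; have [rb sg tp sN' ss'] := step _ _ sN ss cs.
have [h1 _ h2 h3] := IH _ sN' ss' vt; split=> //; first by rewrite rb.
  rewrite tp; case: ts vt h2 {IH h1 h3} => [//|v' ts] /= /andP[cs' vt'] h2.
  have [_ _ tp' _ _] := step _ _ sN' ss' cs'.
  by rewrite h2 tp' /= ltnS (count_shift r0 ss cs cs').
by rewrite big_cons sg h3 -exprD.
Qed.

Lemma chain_valid N r (mu : intpart) (gs : seq intpart) : 0 < r ->
  all (fun g : intpart => size g <= N) (mu :: gs) ->
  path (fun g g' => is_ribbon r g' g) mu gs ->
  exists2 ts, valid_targets r (config N mu) ts &
    gs = [seq part_of s' | s' <- trace r (config N mu) ts].
Proof.
move=> r0; elim: gs mu => [|g gs IH] mu /=; first by exists [::].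
case/and3P=> muN gN gsN /andP[rb pth].
have [v cs e] := ribbon_shift r0 gN muN rb.
have [|ts vt ->] := IH g _ pth; first by rewrite /= gN.
by exists (v :: ts); rewrite /= ?cs -?e ?configK.
Qed.

(** A partition has at most as many parts as boxes, so the final size bounds in advance the number
    of rows of every shape in the chain, and one bead encoding serves them all. *)
Lemma chain_size r (mu : intpart) (gs : seq intpart) :
  path (fun g g' => is_ribbon r g' g) mu gs ->
  all (fun g : intpart => size g <= sumn mu + r * size gs) (mu :: gs) /\
  sumn (last mu gs) = sumn mu + r * size gs.
Proof.
elim: gs mu => [|g gs IH] mu /=; first by rewrite muln0 addn0 andbT leq_size_sumn.
case/andP=> rb /IH [h ->]; have sg := ribbon_sumn rb.
rewrite (leq_trans (leq_size_sumn mu)) ?leq_addr //=.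
rewrite sg mulnS addnA; split=> //.
by move: h; rewrite sg.
Qed.

Section Polyribbon.
Variables (r n N : nat) (mu : intpart).
Hypothesis r0 : 0 < r.
Hypothesis muN : sumn mu + r * n <= N.
Let s := config N mu.
(** A move raises the largest bead by at most r, so n moves from s reach no target beyond [F] -
    1. *)
Let F := (\max_(b <- s) b + r * n).+1.

Definition polyribbon_targets : seq (seq nat) :=
  [seq ts <- targets r (\max_(b <- config N mu) b + r * n).+1 0 (config N mu) | size ts == n].

Let szmu : size mu <= N.
Proof. by apply: leq_trans (leq_size_sumn mu) _; lia. Qed.

Lemma mem_polyribbon_targets (ts : seq nat) : (ts \in polyribbon_targets) =
  [&& size ts == n, valid_targets r s ts & sorted ltn ts].
Proof.
rewrite mem_filter mem_targets -/s -/F add0n.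
have [sz|//] := eqVneq (size ts) n; rewrite /=.
case: (boolP (valid_targets r s ts)) => //= vt; rewrite andb_idr // => _.
have bnd (u t : seq nat) (M : nat) : all (fun b => b <= M) u -> valid_targets r u t ->
    all (fun w => w <= M + r * size t) t.
  elim: t u M => [//|v t IH] u M hM /= /andP[/andP[/hasP[p pu /eqP <-] _] vt'].
  have pM := allP hM p pu; apply/andP; split; first by rewrite mulnS; lia.
  have := IH (shift r (p + r) u) (M + r) _ vt'; rewrite mulnS addnA; apply.
  apply/allP => b; rewrite mem_shift => /predU1P[->|/andP[/andP[/(allP hM) + _] _]]; lia.
have := bnd s ts (\max_(b <- s) b) _ vt.
rewrite sz /F; set M := \max_(_ <- _) _ => hM.
apply: sub_all (hM _) => [w|]; first by rewrite ltnS.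
by apply/allP => b bs; exact: (@leq_bigmax_seq _ _ xpredT id b).
Qed.

Lemma uniq_polyribbon_targets : uniq polyribbon_targets.
Proof. exact/filter_uniq/uniq_targets. Qed.

Definition polyribbon_shape ts : intpart := part_of (shifts r s ts).

Lemma size_shifts (u t : seq nat) : sorted gtn u -> valid_targets r u t ->
  sorted gtn (shifts r u t) /\ size (shifts r u t) = size u.
Proof.
elim: t u => [//|v t IH] u su /= /andP[cs vt].
by have [h1 h2] := IH _ (shift_sorted r v su) vt; split=> //; rewrite h2 size_shift.
Qed.

Lemma polyribbon_shape_inj : {in polyribbon_targets &, injective polyribbon_shape}.
Proof.
move=> t t'; rewrite !mem_polyribbon_targets => /and3P[_ vt st] /and3P[_ vt' st'] e.
have ss : sorted gtn s by exact: config_sorted.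
apply: (targets_inj r0 vt st vt' st').
have [h1 h2] := size_shifts ss vt; have [h1' h2'] := size_shifts ss vt'.
by rewrite -(part_ofK h1) -(part_ofK h1') h2 h2' -/(polyribbon_shape t) e.
Qed.

Lemma polyribbon_shapeP la : is_polyribbon r n la mu <->
  exists2 ts, ts \in polyribbon_targets & la = polyribbon_shape ts.
Proof.
have ss : sorted gtn s by exact: config_sorted.
have sN : size s = N by exact: size_config.
have smu : part_of s = mu by exact: configK.
split=> [[gs [sz /and3P[pth /eqP lst srt]]]|[ts tsP ->]].
  have [szs _] := chain_size pth.
  have [|ts vt e] := chain_valid r0 _ pth (N := N).
    by apply: sub_all szs => g; rewrite sz => /leq_trans; apply.
  have [_ ] := valid_chain r0 sN ss vt; rewrite smu -e => h1 h2 _.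
  exists ts; last by rewrite -lst h1.
  by rewrite mem_polyribbon_targets -sz e size_map size_trace eqxx vt -h2.
move: tsP; rewrite mem_polyribbon_targets => /and3P[/eqP sz vt st].
have [h1 h2 h3 _] := valid_chain r0 sN ss vt; rewrite smu in h1 h2 h3.
exists [seq part_of s' | s' <- trace r s ts]; rewrite size_map size_trace; split=> //.
by apply/and3P; split=> //; [rewrite h2 | rewrite h3].
Qed.

End Polyribbon.

Lemma ribbon_chain_inj r (la mu : intpart) gs gs' : 0 < r ->
  ribbon_chain r la mu gs -> ribbon_chain r la mu gs' -> gs = gs'.
Proof.
move=> r0 /and3P[pth /eqP lst srt] /and3P[pth' /eqP lst' srt'].
have [szs _] := chain_size pth; have [szs' _] := chain_size pth'.
(* The two chains may a priori have different lengths; this many rows suffice for both. *)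
pose N := sumn mu + r * size gs + (sumn mu + r * size gs').
have [|ts vt e] := chain_valid r0 _ pth (N := N).
  by apply: sub_all szs => g /leq_trans; apply; rewrite leq_addr.
have [|ts' vt' e'] := chain_valid r0 _ pth' (N := N).
  by apply: sub_all szs' => g /leq_trans; apply; rewrite leq_addl.
have szmu : size mu <= N by case/andP: szs => /leq_trans h _; apply: h; rewrite leq_addr.
have ss : sorted gtn (config N mu) by exact: config_sorted.
have sN : size (config N mu) = N by exact: size_config.
have smu : part_of (config N mu) = mu by exact: configK.
have [_ h1 h2 _] := valid_chain r0 sN ss vt.
have [_ h1' h2' _] := valid_chain r0 sN ss vt'.
rewrite smu -e in h1 h2; rewrite smu -e' in h1' h2'.
rewrite e e'; congr [seq _ | _ <- trace _ _ _].
apply: (targets_inj r0 vt _ vt'); rewrite -?h2 -?h2' //.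
have [g1 g2] := size_shifts r0 ss vt; have [g1' g2'] := size_shifts r0 ss vt'.
by rewrite -(part_ofK g1) -(part_ofK g1') g2 g2' -h1 -h1' lst lst'.
Qed.

Lemma polyribbon_sgn_chain r (la mu : intpart) gs : 0 < r -> ribbon_chain r la mu gs ->
  polyribbon_sgn r la mu = (\prod_(e <- pairmap (fun g g' => ribbon_sgn g' g) mu gs) e)%R.
Proof.
move=> r0 ch; rewrite /polyribbon_sgn.
have := @xgetPex _ [::] [set gs | ribbon_chain r la mu gs]%classic (ex_intro _ gs ch).
by move=> /(ribbon_chain_inj r0 ch) <-.
Qed.

Lemma polyribbon_shape_sgn r n N (mu : intpart) ts : 0 < r -> sumn mu + r * n <= N ->
  ts \in polyribbon_targets r n N mu ->
  polyribbon_sgn r (polyribbon_shape r N mu ts) mu = ((-1) ^+ jumps r (config N mu) ts)%R.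
Proof.
move=> r0 muN; rewrite mem_polyribbon_targets // => /and3P[/eqP sz vt st].
have ss : sorted gtn (config N mu) by exact: config_sorted.
have szmu : size mu <= N by apply: leq_trans (leq_size_sumn mu) _; lia.
have sN : size (config N mu) = N by exact: size_config.
have smu : part_of (config N mu) = mu by exact: configK.
have [h1 h2 h3 <-] := valid_chain r0 sN ss vt; rewrite smu in h1 h2 h3 *.
apply: polyribbon_sgn_chain => //; apply/and3P; split=> //; last by rewrite h3.
by rewrite h2.
Qed.

(** * The ring of formal series *)

Local Open Scope classical_set_scope.
Local Open Scope ring_scope.

Lemma monomP (m m' : monom) : (forall v : var, m v = m' v) -> m = m'.
Proof. by move=> h; apply/eqP/cmP. Qed.

Lemma mmulI (e : monom) : injective (@mmul monom e).
Proof.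
move=> p q /(congr1 (fun (m : monom) => fun v => m v)) h; apply: monomP => v.
by have := congr1 (@^~ v) h; rewrite /= !cmM => /addnI.
Qed.

(** A factor of m is a choice of exponents on the support of m, all below one bound [B], hence comes
    from a finite function type. *)
Lemma finite_factors (m : monom) : finite_set [set p | exists q, mmul p q = m].
Proof.
pose B := (\max_(v <- finsupp (cmonom_val m)) m v).+1.
pose g (phi : {ffun finsupp (cmonom_val m) -> 'I_B}) : monom :=
  [cmonom (if insub i is Some j then phi j : nat else 0%N) | i in finsupp (cmonom_val m)]%M.
apply: (sub_finite_set (B := range g)); last exact/finite_image/finite_finset.
move=> p [q pq]; have pm v : (p v <= m v)%N by rewrite -pq cmM leq_addr.
have mB v : (m v < B)%N.
  rewrite ltnS; case: (boolP (v \in finsupp (cmonom_val m))) => hv; last first.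
    by rewrite -cmE_eq0 in hv; rewrite (eqP hv).
  exact: (@leq_bigmax_seq _ _ xpredT (fun v => m v)).
exists [ffun j => Ordinal (leq_ltn_trans (pm (val j)) (mB (val j)))] => //.
apply: monomP => v; rewrite /g cmE /= fsfunE.
case: ifP => hv; last first.
  by apply/esym/eqP; rewrite -leqn0 (leq_trans (pm v)) // leqn0 cmE_eq0 hv.
by rewrite insubT ffunE.
Qed.

Definition factors (m : monom) : {fset monom} := fset_set [set p | exists q, mmul p q = m].

Lemma factorsP (m p : monom) : reflect (exists q, mmul p q = m) (p \in factors m).
Proof.
rewrite in_fset_set; last exact: finite_factors.
by apply: (iffP idP); rewrite inE.
Qed.

Lemma factorsM (m p q : monom) : mmul p q = m -> p \in factors m /\ q \in factors m.
Proof.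
by move=> e; split; apply/factorsP; [exists q | exists p; rewrite mulmC].
Qed.

Lemma factors_trans (m p q : monom) : p \in factors m -> q \in factors p -> q \in factors m.
Proof.
by move=> /factorsP[a <-] /factorsP[b <-]; apply/factorsP; exists (mmul b a); rewrite mulmA.
Qed.

Lemma smulE (D : {fset monom}) (f g : series) m : (factors m `<=` D)%fset ->
  smul f g m = \sum_(p <- D) \sum_(q <- D) f p * g q *+ (mmul p q == m).
Proof.
move=> mD; pose r := [seq p <- [seq (p, q) | p <- D, q <- D] | mmul p.1 p.2 == m].
rewrite /smul (@fsbig_fwiden _ _ _ _ r).
- rewrite big_filter big_mkcond big_allpairs.
  by apply: eq_bigr => p _; apply: eq_bigr => q _ /=; case: eqP.
- move=> [p q] /= e; rewrite mem_filter /= e eqxx /=.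
  have [? ?] := factorsM e; apply/allpairsP.
  by exists (p, q); split=> //; exact: (fsubsetP mD).
- by rewrite filter_uniq // allpairs_uniq ?fset_uniq // => -[? ?] [? ?] _ _ [-> ->].
by move=> [p q] [/=]; rewrite mem_filter => /andP[/eqP e _] /(_ e).
Qed.

(** The coefficient of a product at m involves only the factors of m. Replacing each series by an
    element of the monoid algebra with the same coefficients there transfers the ring laws to
    [smul], without nested sums over factorizations. *)
Definition agree m (A : {malg rat[monom]}) (f : series) :=
  forall p, p \in factors m -> A@_p = f p.

Lemma agree_mul m A B f g : agree m A f -> agree m B g -> agree m (A * B) (smul f g).
Proof.
move=> Af Bg n nm.
pose D := (factors n `|` (msupp A `|` msupp B))%fset.
rewrite (@smulE D) ?fsubsetUl // (@mcoeffMlw _ _ D D); last 2 first.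
- exact: fsubset_trans (fsubsetUl _ _) (fsubsetUr _ _).
- exact: fsubset_trans (fsubsetUr _ _) (fsubsetUr _ _).
apply: eq_bigr => p _; apply: eq_bigr => q _.
case: eqP => // e; have [pn qn] := factorsM e.
by rewrite Af ?Bg //; exact: factors_trans nm _.
Qed.

Lemma agree_exists m f : exists A, agree m A f.
Proof.
exists [malg p in factors m => f p] => p pm.
by rewrite mcoeffE pm.
Qed.

Lemma agree_self m A f : agree m A f -> A@_m = f m.
Proof. by apply; apply/factorsP; exists mone; rewrite mulm1. Qed.

Lemma agree_one m : agree m 1 sone.
Proof. by move=> p _; rewrite mcoeff1. Qed.

Lemma agree_add m A B f g : agree m A f -> agree m B g -> agree m (A + B) (f + g).
Proof. by move=> Af Bg p pm; rewrite mcoeffD Af // Bg. Qed.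

Lemma smulA : associative smul.
Proof.
move=> f g h; apply/funext => m.
have [A Af] := agree_exists m f; have [B Bg] := agree_exists m g.
have [C Ch] := agree_exists m h.
rewrite -(agree_self (agree_mul Af (agree_mul Bg Ch))).
by rewrite -(agree_self (agree_mul (agree_mul Af Bg) Ch)) mulrA.
Qed.

Lemma smulC : commutative smul.
Proof.
move=> f g; apply/funext => m.
have [A Af] := agree_exists m f; have [B Bg] := agree_exists m g.
by rewrite -(agree_self (agree_mul Af Bg)) -(agree_self (agree_mul Bg Af)) mulrC.
Qed.

Lemma smul1s : left_id sone smul.
Proof.
move=> f; apply/funext => m; have [A Af] := agree_exists m f.
by rewrite -(agree_self (agree_mul (@agree_one m) Af)) mul1r (agree_self Af).
Qed.

Lemma smulDl : left_distributive smul +%R.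
Proof.
move=> f g h; apply/funext => m.
have [A Af] := agree_exists m f; have [B Bg] := agree_exists m g.
have [C Ch] := agree_exists m h.
rewrite -(agree_self (agree_mul (agree_add Af Bg) Ch)).
by rewrite -(agree_self (agree_add (agree_mul Af Ch) (agree_mul Bg Ch))) mulrDl.
Qed.

Lemma sone_neq0 : sone != 0 :> series.
Proof.
apply/eqP => /(congr1 (@^~ mone)) /eqP.
by rewrite /sone eqxx oner_eq0.
Qed.

HB.instance Definition _ := Monoid.isComLaw.Build series sone smul smulA smulC smul1s.

(** A separate name carries the ring structure whose product is the Cauchy product, to keep it apart
    from the pointwise product of functions. *)
Definition pser : Type := series.
HB.instance Definition _ := GRing.Lmodule.copy pser series.
HB.instance Definition _ :=
  GRing.Zmodule_isComNzRing.Build pser smulA smulC smul1s smulDl sone_neq0.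

Lemma pser0E m : (0 : pser) m = 0.
Proof. by []. Qed.

Lemma pserZE c (f : pser) m : (c *: f) m = c * f m.
Proof. by []. Qed.

Lemma pser_sumE (I : Type) (s : seq I) (P : pred I) (F : I -> pser) m :
  (\sum_(i <- s | P i) F i) m = \sum_(i <- s | P i) F i m.
Proof. by elim/big_rec2: _ => // i x y _ <-. Qed.

Lemma pser_scalerAl c (f g : pser) : c *: (f * g) = (c *: f) * g.
Proof.
apply/funext => m; rewrite pserZE.
rewrite [RHS](smulE _ _ (fsubset_refl _)) [X in c * X](smulE _ _ (fsubset_refl _)).
rewrite mulr_sumr; apply: eq_bigr => p _; rewrite mulr_sumr; apply: eq_bigr => q _.
by rewrite mulrnAr mulrA.
Qed.

HB.instance Definition _ := GRing.Lmodule_isLalgebra.Build rat pser pser_scalerAl.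
HB.instance Definition _ := GRing.Lalgebra_isComAlgebra.Build rat pser.

(** * Monomials as series *)

Definition mono (e : monom) : pser := fun m => (m == e)%:R.

Lemma mono_mulE e (f : pser) m : (mono e * f) (mmul e m) = f m.
Proof.
rewrite -[LHS]/(smul _ _ _) /smul.
rewrite -(@fsbig_widen _ _ _ _ [set (e, m)]) ?fsbig_set1 /= /mono ?eqxx ?mul1r //.
  by move=> p ->.
move=> [p q] [/= pq ne]; have [pe|] := eqVneq p e; last by rewrite mul0r.
by case: ne; rewrite pe in pq *; rewrite (mmulI pq).
Qed.

Lemma mono_mul0 e (f : pser) m : (forall q, mmul e q <> m) -> (mono e * f) m = 0.
Proof.
move=> h; rewrite -[LHS]/(smul _ _ _) /smul fsbig1 // => -[p q] /= pq.
rewrite /mono; have [pe|] := eqVneq p e; last by rewrite mul0r.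
by case: (h q); rewrite -pe.
Qed.

Lemma monoM e e' : mono (mmul e e') = mono e * mono e'.
Proof.
apply/funext => m; have [[q <-]|no] := pselect (exists q, mmul e q = m).
  rewrite mono_mulE /mono; congr (_%:R); congr nat_of_bool.
  by apply/eqP/eqP => [/mmulI|->].
rewrite mono_mul0 => [|q qm]; last by apply: no; exists q.
by rewrite /mono; case: eqP => // me; case: no; exists e'.
Qed.

Lemma mono1 : mono mone = 1.
Proof. by []. Qed.

(** If x_v f = x_w f, the coefficient of f at m equals the one at m x_w / x_v, or is 0 when x_v does
    not divide m. Each such step lowers the exponent of x_v, so the process ends with 0. *)
Lemma var_sub_reg (v w : var) (f : pser) : v != w ->
  (mono (ucm v) - mono (ucm w)) * f = 0 -> f = 0.
Proof.
move=> vw /eqP; rewrite mulrBl subr_eq0 => /eqP e; apply/funext => m; rewrite pser0E.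
have [n] := ubnP (m v); elim: n m => [m|n IH m mn]; first by rewrite ltn0.
rewrite -(mono_mulE (ucm w) f m) -e.
have [mv|mv] := posnP (m v).
  apply: mono_mul0 => q.
  move=> /(congr1 (fun m : monom => m v)) /eqP.
  by rewrite !cmM !cmU eqxx mv [w == v]eq_sym (negPf vw).
pose m' : monom := divcm m (ucm v).
have mE : m = mmul (ucm v) m'.
  apply: monomP => u; rewrite cmM divcmE cmU.
  by case: eqP => [<-|_]; rewrite [RHS]/=; [rewrite subnKC | rewrite add0n subn0].
have -> : mmul (ucm w) m = mmul (ucm v) (mmul (ucm w) m').
  by apply: monomP => u; rewrite {1}mE !cmM addnCA.
rewrite mono_mulE; apply: IH.
rewrite cmM divcmE !cmU eqxx [w == v]eq_sym (negPf vw) add0n.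
by rewrite subn1 -ltnS prednK.
Qed.

(** Substitution of 0 for the variables outside V, which explains why it is compatible with
    products. *)
Definition restrict (V : pred var) (f : pser) : pser :=
  fun m => if all V (finsupp (cmonom_val m)) then f m else 0.

Lemma restrictM V f g : restrict V (f * g) = restrict V f * restrict V g.
Proof.
apply/funext => m.
rewrite [RHS](smulE _ _ (fsubset_refl _)) /restrict.
rewrite [X in if _ then X else _](smulE _ _ (fsubset_refl _)).
have supp (p q : monom) : all V (finsupp (cmonom_val (mmul p q))) =
    all V (finsupp (cmonom_val p)) && all V (finsupp (cmonom_val q)).
  apply/allP/andP => [h|[/allP hp /allP hq] v].
    by split; apply/allP => v vp; apply: h; rewrite mdomD inE vp ?orbT.
  by rewrite mdomD inE => /orP[/hp|/hq].
case: ifP => mV.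
  apply: eq_bigr => p _; apply: eq_bigr => q _.
  case: eqP => // pq; move: mV; rewrite -pq supp => /andP[-> ->] //.
apply/esym/big1 => p _; apply/big1 => q _.
case: eqP => // pq; move: mV; rewrite -pq supp.
by case: ifP; case: ifP; rewrite ?mul0r ?mulr0.
Qed.

Lemma restrict_sum V (I : Type) (s : seq I) (P : pred I) (F : I -> pser) :
  restrict V (\sum_(i <- s | P i) F i) = \sum_(i <- s | P i) restrict V (F i).
Proof.
apply/funext => m; rewrite pser_sumE /restrict.
case: ifP => _; rewrite ?pser_sumE //; last by rewrite big1.
Qed.

Lemma restrictZ V c f : restrict V (c *: f) = c *: restrict V f.
Proof.
by apply/funext => m; rewrite pserZE /restrict; case: ifP; rewrite ?pserZE ?mulr0.
Qed.

(** * Semistandard tableaux and alternants *)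

Local Open Scope nat_scope.

Definition psucc (i : nat) : pnat := @PNat i.+1 isT.

Lemma pval_inj : injective pval.
Proof. exact: val_inj. Qed.

(** The letter [psucc N] has value N + 1. It fills each of the N + 1 rows up to the length that l
    prescribes. *)
Definition glue N (l : seq nat) (T : seq (seq pnat)) : seq (seq pnat) :=
  mkseq (fun j => nth [::] T j ++ nseq (nth 0 l j - size (nth [::] T j)) (psucc N)) N.+1.

(* Deleting the entries N from a semistandard tableau with entries at most N
   leaves a tableau whose shape interlaces with the original shape. Shapes are
   padded with zeros, so that rows may be empty. *)
Fixpoint tabs N (l : seq nat) : seq (seq (seq pnat)) :=
  if N is N'.+1 then [seq glue N' l T | m <- inter l, T <- tabs N' m] else [:: [::]].

Lemma nth_glue N l T j : j <= N -> nth [::] (glue N l T) j =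
  nth [::] T j ++ nseq (nth 0 l j - size (nth [::] T j)) (psucc N).
Proof. by move=> jN; rewrite nth_mkseq. Qed.

(** The conditions range over all j, as rows beyond the list read as empty; this spares range
    conditions in the induction. *)
Definition bounded_ssyt N (l : seq nat) (T : seq (seq pnat)) : Prop :=
  [/\ shape T = l,
      forall j, sorted (fun a b : pnat => a <= b) (nth [::] T j),
      forall j c, c < size (nth [::] T j.+1) ->
        nth (psucc 0) (nth [::] T j) c < nth (psucc 0) (nth [::] T j.+1) c &
      forall j, all (fun a : pnat => a <= N) (nth [::] T j)].

Lemma nth_shape (T : seq (seq pnat)) j : nth 0 (shape T) j = size (nth [::] T j).
Proof.
case: (ltnP j (size T)) => jT; first by rewrite (nth_map [::]).
by rewrite !nth_default ?size_map.
Qed.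

Lemma sorted_row_split N (s : seq pnat) :
  sorted (fun a b : pnat => a <= b) s -> all (fun a : pnat => a <= N.+1) s ->
  let u := [seq a : pnat <- s | a <= N] in s = u ++ nseq (size s - size u) (psucc N).
Proof.
elim: s => [//|a s IH] /= pth /andP[aN sN].
have trl : transitive (fun a b : pnat => a <= b) by move=> x y z; exact: leq_trans.
have := IH (path_sorted pth) sN => /= e; case: ifP => aN' /=; first by rewrite subSS -e.
have aE : a = psucc N by apply: pval_inj => /=; lia.
suff f0 : [seq b : pnat <- s | b <= N] = [::].
  by rewrite f0 /= -aE; congr (_ :: _); rewrite {1}e f0 /= subn0 -aE.
apply/eqP; rewrite -[_ == _]negbK -has_filter; apply/hasPn => b bs.
by move: pth; rewrite (path_sortedE trl) => /andP[/allP/(_ b bs) + _]; rewrite aE /= -ltnNge.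
Qed.

(** Columns increase strictly from a positive entry. With N + 1 rows and entries at most N + 1, the
    last row therefore contains only N + 1, and it becomes empty when this letter is deleted. *)
Lemma ssyt_row_lower N l T j c : sorted geq l -> bounded_ssyt N l T ->
  c < size (nth [::] T j) -> j < nth (psucc 0) (nth [::] T j) c.
Proof.
move=> ls [sh _ col _]; elim: j => [|j IH] cs; first exact: (valP (nth _ _ _)).
apply: leq_trans (col j c cs); apply: IH; apply: leq_trans cs _.
by rewrite -!nth_shape sh; exact: sorted_geq_nth.
Qed.

Lemma inter_sorted l m : sorted geq l -> m \in inter l -> sorted geq m.
Proof.
move=> ls; rewrite mem_inter // => /andP[/eqP sm /allP h].
apply/(sortedP 0) => j jm /=.
have := h j; have := h j.+1; rewrite !mem_iota !add0n -sm jm (ltnW jm) => /(_ isT) + /(_ isT).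
by lia.
Qed.

Lemma size_inter l m : sorted geq l -> m \in inter l -> size m = (size l).-1.
Proof. by move=> ls; rewrite mem_inter // => /andP[/eqP]. Qed.

Lemma tabsP N l T : size l = N -> sorted geq l ->
  T \in tabs N l <-> bounded_ssyt N l T.
Proof.
elim: N l T => [|N IH] l T sl ls.
  rewrite (size0nil sl) /= inE; split=> [/eqP ->|[]]; last by case: T.
  by split=> // j; rewrite nth_nil.
split=> [/allpairsPdep[m [T' [ml T'm ->]]]|T_ok].
  have sm := size_inter ls ml; rewrite sl /= in sm.
  have ms := inter_sorted ls ml.
  have [sh row col bnd] := (IH m T' sm ms).1 T'm.
  have szT' : size T' = N by rewrite -(size_map size) -/(shape T') sh.
  have gap j : j < N -> nth 0 l j.+1 <= nth 0 m j <= nth 0 l j.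
    move: ml; rewrite mem_inter // sl /= => /andP[_ /allP h] jN.
    by apply: h; rewrite mem_iota add0n jN.
  have szle j : size (nth [::] T' j) <= nth 0 l j.
    rewrite -nth_shape sh; case: (ltnP j N) => jN; first by case/andP: (gap j jN).
    by rewrite nth_default // sm.
  have szg j : j <= N -> size (nth [::] (glue N l T') j) = nth 0 l j.
    by move=> jN; rewrite nth_glue // size_cat size_nseq subnKC.
  have big j : ~ j <= N -> nth [::] (glue N l T') j = [::].
    by move=> jN; rewrite nth_default // size_mkseq; lia.
  split.
  - apply: (@eq_from_nth _ 0); first by rewrite size_map size_mkseq sl.
    by move=> j; rewrite size_map size_mkseq ltnS => jN; rewrite nth_shape szg.
  - move=> j; case: (leqP j N) => jN; last by rewrite big //; lia.
    rewrite nth_glue //; have := row j; have := bnd j.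
    case: (nth [::] T' j) => [|a s].
      by move=> _ _ /=; elim: (_ - _) => //= -[|q] //= ->; rewrite leqnn.
    move=> /allP bn pth; rewrite /= cat_path; move: pth => /= -> /=.
    have : last a s <= N.+1 by apply: leqW; apply: bn; exact: mem_last.
    elim: (_ - _) (last a s) => //= q IHq b bN; rewrite bN /=; exact: IHq.
  - move=> j c; case: (leqP j.+1 N) => jN; last by rewrite big //; lia.
    rewrite szg // => cl.
    have cm : c < size (nth [::] T' j).
      by rewrite -nth_shape sh; have := gap j jN; lia.
    rewrite !nth_glue ?(ltnW jN) // !nth_cat cm.
    case: (ltnP c (size (nth [::] T' j.+1))) => cs; first exact: col.
    rewrite nth_nseq; have -> : c - size (nth [::] T' j.+1) <
      nth 0 l j.+1 - size (nth [::] T' j.+1) by lia.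
    by rewrite /= ltnS; apply: (allP (bnd j)); exact: mem_nth.
  move=> j; case: (leqP j N) => jN; last by rewrite big //; lia.
  rewrite nth_glue // all_cat; apply/andP; split.
    by apply: sub_all (bnd j) => a /leqW.
  by apply/allP => a /nseqP[-> _].
have lo := ssyt_row_lower ls T_ok.
have [sh row col bnd] := T_ok.
have szT : size T = N.+1 by rewrite -(size_map size) -/(shape T) sh.
have split_row j := sorted_row_split (row j) (bnd j).
pose u (s : seq pnat) := [seq a : pnat <- s | a <= N].
pose T' := mkseq (fun j => u (nth [::] T j)) N.
have nT' j : j < N -> nth [::] T' j = u (nth [::] T j) by move=> jN; rewrite nth_mkseq.
have uN : u (nth [::] T N) = [::].
  apply/eqP; rewrite -[_ == _]negbK -has_filter; apply/hasPn => b /(nthP (psucc 0))[c cs <-].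
  by rewrite -ltnNge; exact: lo.
have szu j : size (u (nth [::] T j)) <= size (nth [::] T j).
  by rewrite size_filter count_size.
(* Otherwise the first entry N + 1 of row j has a box below it, whose entry would have to exceed N +
   1. *)
have gap j : j < N -> nth 0 l j.+1 <= size (u (nth [::] T j)).
  move=> jN; rewrite leqNgt; apply/negP; rewrite -sh nth_shape => lt.
  have := col j _ lt; rewrite {1}(split_row j) -/(u _) nth_cat ltnn subnn.
  have : nth (psucc 0) (nth [::] T j.+1) (size (u (nth [::] T j))) <= N.+1.
    by apply: (allP (bnd j.+1)); exact: mem_nth.
  rewrite nth_nseq subn_gt0.
  have ll : nth 0 l j.+1 <= nth 0 l j by exact: sorted_geq_nth.
  have -> : size (u (nth [::] T j)) < size (nth [::] T j).
    by apply: leq_trans lt _; rewrite -!nth_shape sh.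
  by rewrite /=; lia.
apply/allpairsPdep; exists (shape T'), T'.
have mi : shape T' \in inter l.
  rewrite mem_inter // size_map size_mkseq sl eqxx /=; apply/allP => j.
  rewrite mem_iota add0n => /= jN; rewrite nth_shape nT' // gap //=.
  by rewrite -sh nth_shape szu.
split=> //.
  apply/IH; [by rewrite size_map size_mkseq | exact: inter_sorted mi |].
  have big j : ~ j < N -> nth [::] T' j = [::].
    by move=> jN; rewrite nth_default // size_mkseq; lia.
  split=> // [j|j c|j]; (case: (ltnP j N) => jN; last by rewrite ?big //; lia).
  - rewrite nT' //; apply: sorted_filter (row j) => x y z; exact: leq_trans.
  - case: (ltnP j.+1 N) => jN'; last by rewrite (big j.+1) //; lia.
    rewrite !nT' // => cs.
    have pre i : i < size (u (nth [::] T j.+1)) ->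
      nth (psucc 0) (nth [::] T j.+1) i = nth (psucc 0) (u (nth [::] T j.+1)) i.
      by move=> h; rewrite {1}(split_row j.+1) nth_cat h.
    have cs' : c < size (u (nth [::] T j)).
      by apply: leq_trans (gap j jN); rewrite -sh nth_shape; apply: leq_trans cs _.
    have := col j c (leq_trans cs (szu _)); rewrite pre //.
    by rewrite {1}(split_row j) -/(u _) nth_cat cs'.
  - by rewrite nT' //; apply: filter_all.
apply: (@eq_from_nth _ [::]); first by rewrite size_mkseq.
move=> j; rewrite szT ltnS => jN; rewrite nth_glue //.
move: (jN); rewrite leq_eqVlt => /predU1P[jE|jN'].
  rewrite jE (nth_default [::] (s := T')) ?size_mkseq //= subn0 -sh nth_shape.
  by rewrite {1}(split_row N) -/(u _) uN /= subn0.
by rewrite nT' // -sh nth_shape {1}(split_row j).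
Qed.

(** Keeping only the entries at most N undoes [glue], and the interlacing shape is the shape of what
    is left. *)
Lemma tabs_uniq N l : size l = N -> sorted geq l -> uniq (tabs N l).
Proof.
elim: N l => [//|N IH] l sl ls /=.
apply: allpairs_uniq_dep => [|m ml|]; first exact: uniq_inter.
  by apply: IH; [rewrite (size_inter ls ml) sl | exact: inter_sorted ml].
have key m T : m \in inter l -> T \in tabs N m -> m = shape T /\
    forall j, j < N -> nth [::] T j = [seq a : pnat <- nth [::] (glue N l T) j | a <= N].
  move=> ml; have sm : size m = N by rewrite (size_inter ls ml) sl.
  move=> /(tabsP _ sm (inter_sorted ls ml))[sh _ _ bnd]; split=> // j jN.
  rewrite nth_glue ?(ltnW jN) // filter_cat.
  have /all_filterP -> := bnd j.
  suff -> q : [seq a : pnat <- nseq q (psucc N) | a <= N] = [::] by rewrite cats0.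
  by elim: q => //= q ->; rewrite ltnn.
move=> _ _ /allpairsPdep[m [T [ml Tm ->]]] /allpairsPdep[m' [T' [ml' Tm' ->]]] /= e.
have [mE h] := key m T ml Tm; have [mE' h'] := key m' T' ml' Tm'.
suff TE : T = T' by rewrite mE mE' TE.
have sz := size_inter ls ml; have sz' := size_inter ls ml'.
have szT : size T = N by rewrite -(size_map size) -/(shape T) -mE sz sl.
have szT' : size T' = N by rewrite -(size_map size) -/(shape T') -mE' sz' sl.
apply: (@eq_from_nth _ [::]); first by rewrite szT szT'.
by move=> j; rewrite szT => jN; rewrite h // h' // e.
Qed.

Local Open Scope ring_scope.

Section Tableaux.
Variable k : pnat.

Definition xvar (i : nat) : pser := mono (ucm ((k, psucc i) : var)).

Definition tabs_sum N (l : seq nat) : pser := \sum_(T <- tabs N l) mono (tableau_monom k T).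

Fixpoint vandermonde N : pser :=
  if N is N'.+1 then vandermonde N' * \prod_(i < N') (xvar i - xvar N') else 1.

Lemma vandermonde_reg N (f : pser) : vandermonde N * f = 0 -> f = 0.
Proof.
elim: N f => [|N IH] f /=; first by rewrite mul1r.
rewrite -mulrA => /IH; elim/big_ind: _ f => [f|a b IHa IHb f|i _ f].
- by rewrite mul1r.
- by rewrite -mulrA => /IHa/IHb.
- apply: var_sub_reg; rewrite xpair_eqE eqxx /= -val_eqE /= eqSS.
  by rewrite ltn_eqF.
Qed.

Lemma mono_tableau (T : seq (seq pnat)) :
  mono (tableau_monom k T) = \prod_(row <- T) \prod_(c <- row) mono (ucm ((k, c) : var)).
Proof. by rewrite -big_flatten; exact: (big_morph mono monoM mono1). Qed.

Lemma tabs_sum_rec N l : size l = N.+1 -> sorted geq l ->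
  tabs_sum N.+1 l = \sum_(m <- inter l) xvar N ^+ (sumn l - sumn m) * tabs_sum N m.
Proof.
move=> sl ls; rewrite /tabs_sum /= big_allpairs_dep; apply: eq_big_seq => m ml.
have sm : size m = N by rewrite (size_inter ls ml) sl.
rewrite mulr_sumr; apply: eq_big_seq => T /(tabsP _ sm (inter_sorted ls ml))[sh _ _ _].
have szT : size T = N by rewrite -(size_map size) -/(shape T) sh.
rewrite !mono_tableau /glue big_map -[iota 0 N.+1]/(index_iota 0 N.+1) big_mkord.
have -> : \prod_(row <- T) \prod_(c <- row) mono (ucm ((k, c) : var)) =
   \prod_(j < N.+1) \prod_(c <- nth [::] T j) mono (ucm ((k, c) : var)).
  rewrite big_ord_recr /= [nth _ _ N]nth_default ?szT // big_nil mulr1.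
  by rewrite (big_nth [::]) szT big_mkord.
rewrite mulrC -[X in _ ^+ X](_ : (\sum_(j < N.+1) (nth 0 l j - size (nth [::] T j)))%N = _).
  rewrite -prodrXr -big_split /=; apply: eq_bigr => j _.
  by rewrite big_cat /= big_nseq iter_mulr_1.
rewrite !sumn_nth sl sm [in RHS]big_ord_recr /= big_ord_recr /=.
rewrite (nth_default _ (_ : (size T <= N)%N)) ?szT // subn0.
have -> : (\sum_(i < N) nth 0 l i = \sum_(i < N) (nth 0 l i - size (nth [::] T i)) +
    \sum_(i < N) nth 0 m i)%N.
  rewrite -big_split /=; apply: eq_bigr => i _.
  rewrite -sh nth_shape subnK // -nth_shape sh.
  move: ml; rewrite mem_inter // sl /= => /andP[_ /allP/(_ (val i))].
  by rewrite mem_iota add0n ltn_ord => /(_ isT)/andP[].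
by rewrite addnAC addnK.
Qed.

Lemma alternant_tabs N l : size l = N -> sorted geq l ->
  alternant N (pw xvar) (beads l) = vandermonde N * tabs_sum N l.
Proof.
elim: N l => [|N IH] l sl ls.
  rewrite /alternant det_mx00 mul1r /tabs_sum big_seq1.
  by rewrite mono_tableau big_nil.
rewrite alternant_branch // tabs_sum_rec //= -mulrA mulrCA; congr (_ * _).
rewrite mulr_sumr; apply: eq_big_seq => m ml.
have sm : size m = N by rewrite (size_inter ls ml) sl.
by rewrite (IH m sm (inter_sorted ls ml)) mulrCA.
Qed.

Definition bounded_var N : pred var := fun v => (v.2 <= N)%N.

Lemma tableau_monomE (T : seq (seq pnat)) (v : var) :
  tableau_monom k T v = count (fun c => (k, c) == v) (flatten T).
Proof.
rewrite /tableau_monom; elim: (flatten T) => [|c s IH] /=; first by rewrite big_nil cm1.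
by rewrite big_cons cmM IH cmU.
Qed.

Lemma tableau_monom_bounded N (T : seq (seq pnat)) :
  all (bounded_var N) (finsupp (cmonom_val (tableau_monom k T))) =
  all (fun c : pnat => c <= N)%N (flatten T).
Proof.
apply/allP/allP => [h c cT|h v].
  apply: (h (k, c)); rewrite -cmE_neq0 tableau_monomE -lt0n -has_count.
  by apply/hasP; exists c.
rewrite -cmE_neq0 tableau_monomE -lt0n -has_count => /hasP[c cT /eqP <-].
exact: h.
Qed.

Definition pad_tab N (T : seq (seq pnat)) := T ++ nseq (N - size T) [::].

Lemma shape_pad_tab N T : shape (pad_tab N T) = pad N (shape T).
Proof. by rewrite /pad /shape map_cat map_nseq size_map. Qed.

Lemma flatten_pad_tab N T : flatten (pad_tab N T) = flatten T.
Proof.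
rewrite flatten_cat; suff -> q : flatten (nseq q ([::] : seq pnat)) = [::] by rewrite cats0.
by elim: q.
Qed.

Lemma nth_pad_tab N T j : nth [::] (pad_tab N T) j = nth [::] T j.
Proof. by rewrite nth_cat nth_nseq if_same; case: ltnP => // /(nth_default [::]) ->. Qed.

Lemma ssyt_bounded N (la : intpart) (T : seq (seq pnat)) : (size la <= N)%N ->
  ssyt la T && all (fun c : pnat => c <= N)%N (flatten T) <->
  shape T = la /\ bounded_ssyt N (pad N la) (pad_tab N T).
Proof.
move=> laN.
have colE : shape T = la -> sorted (fun r1 r2 : seq pnat =>
        all (fun p : pnat * pnat => p.1 < p.2)%N (zip r1 r2)) T <->
   forall j c, (c < size (nth [::] T j.+1))%N ->
        (nth (psucc 0) (nth [::] T j) c < nth (psucc 0) (nth [::] T j.+1) c)%N.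
  move=> sh.
  have le j : (size (nth [::] T j.+1) <= size (nth [::] T j))%N.
    by rewrite -!nth_shape sh; exact/sorted_geq_nth/intpart_sorted.
  have zipE j : all (fun p : pnat * pnat => p.1 < p.2)%N (zip (nth [::] T j) (nth [::] T j.+1)) <->
      forall c, (c < size (nth [::] T j.+1))%N ->
        (nth (psucc 0) (nth [::] T j) c < nth (psucc 0) (nth [::] T j.+1) c)%N.
    have szz : size (zip (nth [::] T j) (nth [::] T j.+1)) = size (nth [::] T j.+1).
      by rewrite size_zip; apply/minn_idPr.
    split=> [/(all_nthP (psucc 0, psucc 0)) h c cs|h].
      have := h c; rewrite szz => /(_ cs).
      by rewrite nth_zip_cond szz cs.
    apply/(all_nthP (psucc 0, psucc 0)) => c; rewrite szz => cs.
    by rewrite nth_zip_cond szz cs /=; exact: h.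
  split=> [/(sortedP [::]) h j|h].
    case: (ltnP j.+1 (size T)) => jT; first by apply/zipE; exact: h.
    by move=> c; rewrite [nth _ _ j.+1]nth_default.
  by apply/(sortedP [::]) => j jT; apply/zipE; exact: h.
split=> [/andP[/and3P[/eqP sh /allP row col] bnd]|[sh [_ row col bnd]]].
  split=> //; split.
  - by rewrite shape_pad_tab sh.
  - move=> j; rewrite nth_pad_tab; case: (ltnP j (size T)) => jT.
      by apply: row; exact: mem_nth.
    by rewrite nth_default.
  - by move=> j c; rewrite !nth_pad_tab; exact: ((colE sh).1 col j c).
  - move=> j; rewrite nth_pad_tab; case: (ltnP j (size T)) => jT; last by rewrite nth_default.
    apply/allP => c cs; apply: (allP bnd); apply/flattenP.
    by exists (nth [::] T j) => //; exact: mem_nth.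
apply/andP; split.
  apply/and3P; split; first by rewrite sh.
    by apply/allP => r /(nthP [::])[j jT <-]; have := row j; rewrite nth_pad_tab.
  by apply/(colE sh) => j c cs; have := col j c; rewrite !nth_pad_tab; exact.
apply/allP => c /flattenP[r /(nthP [::])[j jT <-] cr].
by have := bnd j; rewrite nth_pad_tab => /allP; exact.
Qed.

(** The monomial of a tableau survives the restriction exactly when all its entries are at most N,
    and such tableaux correspond to padded ones by adding or removing empty rows. *)
Lemma schur_restrict N (la : intpart) : (size la <= N)%N ->
  restrict (bounded_var N) (schur k la) = tabs_sum N (pad N la).
Proof.
move=> laN; apply/funext => m; rewrite /restrict /tabs_sum pser_sumE.
have spad : size (pad N la) = N by exact: size_pad.
have srt : sorted geq (pad N la) by apply/sorted_pad/intpart_sorted.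
have unpad T : T \in tabs N (pad N la) -> pad_tab N (take (size la) T) = T /\
    shape (take (size la) T) = la.
  move=> /(tabsP _ spad srt)[sh _ _ _].
  have szT : size T = N by rewrite -(size_map size) -/(shape T) sh.
  have sh1 : shape (take (size la) T) = la.
    by rewrite /shape map_take -/(shape T) sh take_size_cat.
  split=> //; rewrite -[RHS](cat_take_drop (size la)) /pad_tab; congr (_ ++ _).
  rewrite size_takel ?szT //.
  have : shape (drop (size la) T) = nseq (N - size la) 0%N.
    by rewrite /shape map_drop -/(shape T) sh drop_size_cat.
  have : size (drop (size la) T) = (N - size la)%N by rewrite size_drop szT.
  by elim: (drop _ _) (N - size la)%N => [|[|? ?] D IH] [|q] //= [/IH h] [/h ->].
case: ifP => mN; last first.
  rewrite big_seq big1 // => T /(tabsP _ spad srt)[_ _ _ bnd]; rewrite /mono.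
  case: eqP => // e; move: mN; rewrite e tableau_monom_bounded.
  by case/allP => c /flattenP[r /(nthP [::])[j jT <-]]; move/allP: (bnd j); exact.
pose r := [seq take (size la) T | T <- tabs N (pad N la) & tableau_monom k T == m].
have -> : schur k la m = \sum_(T <- r) 1.
  rewrite /schur (@fsbig_seq _ _ _ _ r); last first.
    rewrite map_inj_in_uniq ?filter_uniq ?tabs_uniq // => T T'.
    rewrite !mem_filter => /andP[_ /unpad[h _]] /andP[_ /unpad[h' _]] e.
    by rewrite -h -h' e.
  apply: eq_fsbigl; apply/seteqP; split=> T /=.
    case=> ss e; apply/mapP; exists (pad_tab N T).
      rewrite mem_filter /tableau_monom flatten_pad_tab -/(tableau_monom k T) e eqxx /=.
      apply/(tabsP _ spad srt).
      have [] // := (ssyt_bounded T laN).1.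
      by rewrite ss -tableau_monom_bounded e.
    have sz : size T = size la.
      by rewrite -(size_map size) -/(shape T); case/and3P: ss => /eqP ->.
    by rewrite -sz take_size_cat.
  case/mapP => T'; rewrite mem_filter => /andP[/eqP <- T'in] ->.
  have [h sh] := unpad _ T'in; split.
    suff /(ssyt_bounded _ laN)/andP[] : shape (take (size la) T') = la /\
      bounded_ssyt N (pad N la) (pad_tab N (take (size la) T')) by [].
    by split=> //; rewrite h; exact/(tabsP _ spad srt).
  by rewrite -[in RHS]h /tableau_monom flatten_pad_tab.
rewrite big_map big_filter big_mkcond /=; apply: eq_bigr => T _.
by rewrite /mono eq_sym; case: eqP.
Qed.

End Tableaux.

(** * Complete homogeneous functions in powers of the variables *)

Local Notation supp m := (finsupp (cmonom_val m)).

Lemma expcmnE (m : monom) n (v : var) : expcmn m n v = (n * m v)%N.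
Proof.
rewrite /expcmn; case: n => [|n]; first by rewrite onecmE.
rewrite iteropS; elim: n => [|n IH]; first by rewrite mul1n.
by rewrite iterS mulcmE IH mulSn.
Qed.

Lemma monoX (e : monom) n : mono (expcmn e n) = mono e ^+ n.
Proof.
elim: n => [|n IH]; first exact: mono1.
rewrite exprS -IH -monoM; congr mono; apply: monomP => v.
by rewrite cmM !expcmnE mulSn.
Qed.

Definition wt (om : var -> nat) (m : monom) : nat := (\sum_(v <- supp m) om v * m v)%N.

Lemma wtE om (m : monom) (D : {fset var}) : (supp m `<=` D)%fset ->
  wt om m = (\sum_(v <- D) om v * m v)%N.
Proof.
move=> mD; rewrite /wt; apply: big_fset_incl => // v vD.
by rewrite -cmE_eq0 => /eqP ->; rewrite muln0.
Qed.

Lemma wtM om (p q : monom) : wt om (mmul p q) = (wt om p + wt om q)%N.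
Proof.
have e : supp (mmul p q) = (supp p `|` supp q)%fset by exact: mdomD.
rewrite (@wtE _ p (supp (mmul p q))); last by rewrite e fsubsetUl.
rewrite (@wtE _ q (supp (mmul p q))); last by rewrite e fsubsetUr.
by rewrite -big_split /=; apply: eq_bigr => v _; rewrite cmM mulnDr.
Qed.

Lemma all_supp (P : pred var) (m : monom) :
  reflect (forall v, (0 < m v)%N -> P v) (all P (supp m)).
Proof.
by apply: (iffP allP) => h v; have := h v; rewrite -cmE_neq0 lt0n.
Qed.

Definition mrest (V : pred var) (m : monom) : monom :=
  [cmonom (if V v then m v else 0%N) | v in supp m]%M.

Lemma mrestE V (m : monom) (v : var) : mrest V m v = if V v then m v else 0%N.
Proof.
rewrite /mrest cmE /= fsfunE; case: ifP => // /negbT.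
by rewrite -cmE_eq0 => /eqP ->; rewrite if_same.
Qed.

(** * Products of series in disjoint sets of variables *)

Section Split.
Variables V1 V2 : pred var.
Hypothesis V12 : forall v, V1 v -> ~~ V2 v.

Lemma mrest_split (p q m : monom) : mmul p q = m ->
  all V1 (supp p) -> all V2 (supp q) ->
  [/\ p = mrest V1 m, q = mrest V2 m & all (predU V1 V2) (supp m)].
Proof.
move=> <- /all_supp p1 /all_supp q2; split.
- apply: monomP => v; rewrite mrestE cmM; case: ifP => v1.
    case: (posnP (q v)) => [->|/q2 v2]; first by rewrite addn0.
    by have := V12 v1; rewrite v2.
  by case: (posnP (p v)) => // /p1; rewrite v1.
- apply: monomP => v; rewrite mrestE cmM; case: ifP => v2.
    case: (posnP (p v)) => [->//|/p1 /V12].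
    by rewrite v2.
  by case: (posnP (q v)) => // /q2; rewrite v2.
apply/all_supp => v; rewrite cmM addn_gt0 /= => /orP[/p1 ->//|/q2 ->].
by rewrite orbT.
Qed.

Lemma mrestK (m : monom) : all (predU V1 V2) (supp m) ->
  mmul (mrest V1 m) (mrest V2 m) = m.
Proof.
move=> /all_supp h; apply: monomP => v; rewrite cmM !mrestE.
case: (posnP (m v)) => [->|/h /=]; first by rewrite !if_same.
case: ifP => [/V12 /negPf ->|_ /= ->]; by rewrite ?addn0.
Qed.

(** A monomial has at most one factorization whose factors lie in the two disjoint sets of
    variables, so the Cauchy sum has at most one nonzero term. *)
Lemma smul_split (f g : pser) m :
  (forall p, ~~ all V1 (supp p) -> f p = 0) -> (forall q, ~~ all V2 (supp q) -> g q = 0) ->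
  (f * g) m = if all (predU V1 V2) (supp m) then f (mrest V1 m) * g (mrest V2 m) else 0.
Proof.
move=> f0 g0; rewrite -[LHS]/(smul _ _ _) /smul.
have fg0 (p q : monom) : mmul p q = m ->
   (p, q) <> (mrest V1 m, mrest V2 m) \/ ~~ all (predU V1 V2) (supp m) -> f p * g q = 0.
  move=> pq h; case: (boolP (all V1 (supp p))) => [p1|/f0 ->]; last by rewrite mul0r.
  case: (boolP (all V2 (supp q))) => [q2|/g0 ->]; last by rewrite mulr0.
  have [e1 e2 e3] := mrest_split pq p1 q2.
  by case: h => [[]|]; [rewrite -e1 -e2 | rewrite e3].
case: ifP => mV.
  rewrite -(@fsbig_widen _ _ _ _ [set (mrest V1 m, mrest V2 m)]) ?fsbig_set1 //=.
    by move=> p /= ->; exact: mrestK.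
  by move=> [p q] [/= pq ne]; apply: fg0 pq _; left.
by rewrite fsbig1 // => -[p q] /= pq; apply: fg0 pq _; right; rewrite mV.
Qed.

End Split.

(* The complete homogeneous function of degree d (for the grading om) in the
   r-th powers of the variables in V. *)
Definition hgen (om : var -> nat) (V : pred var) (r d : nat) : pser := fun m =>
  (all (fun v => V v && (r %| m v)%N) (supp m) && (wt om m == d * r)%N)%:R.

Lemma hgen_out om V r d m : ~~ all V (supp m) -> hgen om V r d m = 0.
Proof.
move=> h; rewrite /hgen; case: allP => //= h'; case/allP: h => v vm.
by have /andP[] := h' v vm.
Qed.

Lemma eq_hgen om V V' r d : V =1 V' -> hgen om V r d = hgen om V' r d.
Proof.
move=> VV; apply/funext => m; rewrite /hgen; congr ((_ && _)%:R).
by apply: eq_all => v; rewrite VV.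
Qed.

Lemma restrict_hgen V om V' r d :
  restrict V (hgen om V' r d) = hgen om (predI V V') r d.
Proof.
apply/funext => m; rewrite /restrict; case: ifP => mV; last first.
  rewrite hgen_out //; apply: contraFN mV; apply: sub_all => v /=.
  by case/andP.
rewrite /hgen; congr ((_ && _)%:R); apply: eq_in_all => v vm /=.
by rewrite (allP mV v vm).
Qed.

Lemma dvdn_wt om r (m : monom) : all (fun v => r %| m v)%N (supp m) -> (r %| wt om m)%N.
Proof.
move=> /allP h; rewrite /wt; elim/big_ind: _ => [||v _]; [exact: dvdn0|exact: dvdn_add|].
case: (boolP (v \in supp m)) => vm; first by rewrite dvdn_mull // h.
by rewrite -cmE_eq0 in vm; rewrite (eqP vm) muln0 dvdn0.
Qed.

(** Every monomial in the union is the product of its V1 part and its V2 part. When all exponents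
    are multiples of r, so are both weights, and the only summand that sees the monomial is a =
    (weight of the V1 part) / r. *)
Lemma hgenU om (V1 V2 : pred var) r d : (0 < r)%N -> (forall v, V1 v -> ~~ V2 v) ->
  hgen om (predU V1 V2) r d = \sum_(a < d.+1) hgen om V1 r a * hgen om V2 r (d - a).
Proof.
move=> r0 V12; apply/funext => m; rewrite pser_sumE.
under eq_bigr => a _ do
  rewrite (smul_split V12 m (fun p => @hgen_out om V1 r a p)
    (fun p => @hgen_out om V2 r (d - a) p)).
case: (boolP (all (predU V1 V2) (supp m))) => mV; last by rewrite hgen_out // big1.
set p := mrest V1 m; set q := mrest V2 m.
have pq : mmul p q = m by exact: mrestK.
have allE : all (fun v => predU V1 V2 v && (r %| m v)%N) (supp m) =
   all (fun v => V1 v && (r %| p v)%N) (supp p) && all (fun v => V2 v && (r %| q v)%N) (supp q).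
  apply/all_supp/andP => [h|[/all_supp hp /all_supp hq] v].
    split; apply/all_supp => v; rewrite mrestE; case: ifP => // v1 /h /andP[] //.
  move/all_supp: mV => /(_ v) mV mv; rewrite mV //=.
  have := hp v; have := hq v; rewrite !mrestE; have := mV mv => /=.
  case: (boolP (V1 v)) => [v1 _ _ /(_ mv)|_ /= ->] //.
  by move=> /(_ mv).
rewrite /hgen allE -{1}pq wtM.
case: (boolP (all _ (supp p))) => hp /=; last by rewrite big1 // => a _; rewrite mul0r.
case: (boolP (all _ (supp q))) => hq /=; last by rewrite big1 // => a _; rewrite mulr0.
have /dvdnP[wp ep] : (r %| wt om p)%N.
  by apply: dvdn_wt; apply: sub_all hp => v /andP[].
have /dvdnP[wq eq_] : (r %| wt om q)%N.
  by apply: dvdn_wt; apply: sub_all hq => v /andP[].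
rewrite ep eq_ -mulnDl eqn_pmul2r //.
under eq_bigr do rewrite !eqn_pmul2r // -natrM mulnb.
case: eqP => [e|ne].
  have wpd : (wp < d.+1)%N by rewrite -e; lia.
  have wqE : wq == (d - wp)%N by rewrite -e addKn.
  rewrite (bigD1 (Ordinal wpd)) //= eqxx wqE big1 ?addr0 // => a.
  by rewrite -val_eqE /= eq_sym => /negPf ->.
rewrite big1 // => a _; case: (eqVneq wp a) => //= wa; case: eqP => // wqa.
by have := ltn_ord a; lia.
Qed.

Lemma pser_boolE (b : bool) m : (b%:R : pser) m = (b && (m == mone))%:R.
Proof. by case: b; rewrite ?mulr1n ?mulr0n ?pser0E. Qed.

Lemma hgen0 om r d : (0 < r)%N -> hgen om pred0 r d = (d == 0%N)%:R.
Proof.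
move=> r0; apply/funext => m; rewrite pser_boolE /hgen.
have [->|m1] := eqVneq m mone.
  have s0 : supp (mone : monom) = fset0 by exact: mdom1.
  rewrite s0 /= /wt s0 big_seq_fset0 eq_sym muln_eq0.
  by rewrite [r == _]eqn0Ngt r0 orbF andbT.
rewrite andbF (_ : all _ _ = false) //.
apply/negbTE/negP => /all_supp h; case/eqP: m1; apply: monomP => v; rewrite cm1.
by case: (posnP (m v)) => // /h.
Qed.

Lemma hgen1 v r d : hgen (fun=> 1%N) (pred1 v) r d = mono (ucm v) ^+ (r * d).
Proof.
rewrite -monoX; apply/funext => m; rewrite /hgen /mono; congr (_%:R); congr nat_of_bool.
apply/andP/eqP => [[/all_supp h /eqP w]|->].
  have sm : (supp m `<=` [fset v])%fset.
    apply/fsubsetP => u; rewrite -cmE_neq0 -lt0n => /h /andP[/= /eqP -> _].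
    by rewrite inE.
  move: w; rewrite (wtE _ sm) big_seq_fset1 mul1n => w.
  apply: monomP => u; rewrite expcmnE cmU; case: eqP => [<-|/eqP vu].
    by rewrite muln1 mulnC.
  by rewrite muln0; case: (posnP (m u)) => // /h /andP[/= /eqP uv]; rewrite uv eqxx in vu.
have sm : (supp (expcmn (ucm v) (r * d)) `<=` [fset v])%fset.
  apply/fsubsetP => u; rewrite -cmE_neq0 expcmnE cmU inE [u == v]eq_sym.
  by case: (v == u) => //; rewrite muln0.
split.
  apply/all_supp => u; rewrite expcmnE cmU [v == u]eq_sym /=.
  by case: (u == v); rewrite ?muln0 //= muln1 dvdn_mulr.
by rewrite (wtE _ sm) big_seq_fset1 mul1n expcmnE cmU eqxx muln1 mulnC.
Qed.

(** * One alphabet *)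

(** This number of rows is enough for every partition obtained; [perm_polyribbons] shows that more
    rows give the same partitions. *)
Definition polyribbons r n (mu : intpart) : seq intpart :=
  let N := (sumn mu + r * n)%N in
  [seq polyribbon_shape r N mu ts | ts <- polyribbon_targets r n N mu].

Lemma polyribbonsP r n (mu la : intpart) : (0 < r)%N ->
  la \in polyribbons r n mu <-> is_polyribbon r n la mu.
Proof.
move=> r0; rewrite (polyribbon_shapeP r0 (leqnn _)); split=> [/mapP|[ts]].
  by case=> ts; exists ts.
by move=> tsP ->; exact: map_f.
Qed.

Lemma polyribbons_uniq r n (mu : intpart) : (0 < r)%N -> uniq (polyribbons r n mu).
Proof.
move=> r0; rewrite map_inj_in_uniq ?uniq_polyribbon_targets //.
exact: polyribbon_shape_inj.
Qed.

Lemma perm_polyribbons r n N (mu : intpart) : (0 < r)%N -> (sumn mu + r * n <= N)%N ->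
  perm_eq (polyribbons r n mu)
    [seq polyribbon_shape r N mu ts | ts <- polyribbon_targets r n N mu].
Proof.
move=> r0 muN; apply: uniq_perm; first exact: polyribbons_uniq.
  rewrite map_inj_in_uniq ?uniq_polyribbon_targets //.
  exact: polyribbon_shape_inj.
move=> la; apply/idP/idP => [/(polyribbonsP _ _ _ r0)|/mapP[ts tsP ->]].
  by move=> /(polyribbon_shapeP r0 muN)[ts tsP ->]; exact: map_f.
by apply/(polyribbonsP _ _ _ r0)/(polyribbon_shapeP r0 muN); exists ts.
Qed.

Section OneAlphabet.
Variable k : pnat.

Definition kvar : pred var := fun v => v.1 == k.

(** Induction on the number of variables: by [hgenU], a new variable x contributes the geometric
    series of x^r. *)
Lemma hgen_prod r N n c : (0 < r)%N -> (c <= n)%N ->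
  hgen (fun=> 1%N) (predI (bounded_var N) kvar) r c =
  (\prod_(i < N) \poly_(j < n.+1) xvar k i ^+ (r * j))`_c.
Proof.
move=> r0; elim: N c => [|N IH] c cn.
  rewrite big_ord0 coef1 -(hgen0 (fun=> 1%N) _ r0); apply: eq_hgen => v /=.
  by rewrite /bounded_var leqNgt (valP v.2).
rewrite big_ord_recr coefM /=.
have -> : hgen (fun=> 1%N) (predI (bounded_var N.+1) kvar) r c =
    hgen (fun=> 1%N) (predU (predI (bounded_var N) kvar) (pred1 ((k, psucc N) : var))) r c.
  apply: eq_hgen => -[a b]; rewrite /bounded_var /kvar /= xpair_eqE.
  rewrite -[b == _]val_eqE /= leq_eqVlt ltnS.
  by case: (a == k); rewrite ?andbT ?andbF ?orbF //= orbC.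
rewrite hgenU //; last first.
  move=> [a b]; rewrite /bounded_var /kvar /= xpair_eqE => /andP[bN _].
  rewrite negb_and -[b == _]val_eqE /=; apply/orP; right.
  by rewrite neq_ltn ltnS bN.
apply: eq_bigr => a _; have an : (a <= n)%N by rewrite (leq_trans _ cn) // -ltnS.
rewrite hgen1 IH // coef_poly ltnS (leq_trans (leq_subr _ _) cn) //.
Qed.

Lemma one_alphabet_bounded r n N (mu : intpart) : (0 < r)%N -> (sumn mu + r * n <= N)%N ->
  tabs_sum k N (pad N mu) * (\prod_(i < N) \poly_(j < n.+1) xvar k i ^+ (r * j))`_n =
  \sum_(ts <- polyribbon_targets r n N mu)
     (-1) ^+ jumps r (config N mu) ts * tabs_sum k N (pad N (polyribbon_shape r N mu ts)).
Proof.
move=> r0 muN; apply/eqP; rewrite -subr_eq0; apply/eqP/(@vandermonde_reg k N).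
have szmu : (size mu <= N)%N.
  by apply: leq_trans (leq_size_sumn mu) _; exact: leq_trans (leq_addr _ _) muN.
have ss := config_sorted N mu; have sN := size_config szmu.
rewrite mulrBr mulrA -alternant_tabs ?size_pad //; last exact/sorted_pad/intpart_sorted.
rewrite (@alternant_hpower _ r n _ r0 N (\max_(b <- config N mu) b + r * n).+1) //; last first.
  apply/allP => b bs; rewrite ltnS leq_add2r.
  exact: (@leq_bigmax_seq _ _ xpredT id b).
apply/eqP; rewrite subr_eq0; apply/eqP.
rewrite /polyribbon_targets [in RHS]big_filter mulr_sumr -/(config N mu).
rewrite big_seq_cond [RHS]big_seq_cond; apply: eq_bigr => ts /andP[ts1 ts2].
have : ts \in polyribbon_targets r n N mu by rewrite mem_filter ts2.
rewrite mem_polyribbon_targets // => /and3P[_ vt _].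
have [h1 h2] := size_shifts r0 ss vt.
rewrite mulrCA; congr (_ * _); rewrite -alternant_tabs.
- by have := part_ofK h1; rewrite h2 sN => e; rewrite -[in LHS]e.
- by rewrite size_pad // (leq_trans (size_part_of _)) // h2 sN.
- exact/sorted_pad/intpart_sorted.
Qed.

Lemma one_alphabet r n (mu : intpart) : (0 < r)%N ->
  (schur k mu : pser) * hgen (fun=> 1%N) kvar r n =
  \sum_(la <- polyribbons r n mu) polyribbon_sgn r la mu *: (schur k la : pser).
Proof.
move=> r0; apply/funext => m.
pose N := (sumn mu + r * n + \max_(v <- supp m) pval v.2)%N.
have mN : all (bounded_var N) (supp m).
  apply/allP => v vm; rewrite /bounded_var /N; apply: leq_trans (leq_addl _ _).
  exact: (@leq_bigmax_seq _ _ xpredT (fun v : var => pval v.2)).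
have muN : (sumn mu + r * n <= N)%N by rewrite leq_addr.
have atm (f : pser) : f m = restrict (bounded_var N) f m by rewrite /restrict mN.
rewrite atm [RHS]atm; congr (_ m).
rewrite restrictM restrict_sum restrict_hgen (@hgen_prod _ N n n) //.
have szmu : (size mu <= N)%N.
  by apply: leq_trans (leq_size_sumn mu) _; exact: leq_trans (leq_addr _ _) muN.
rewrite schur_restrict // one_alphabet_bounded //.
rewrite (perm_big _ (perm_polyribbons r0 muN)) big_map.
apply: eq_big_seq => ts tsP; rewrite restrictZ (polyribbon_shape_sgn r0 muN tsP).
rewrite schur_restrict.
  by rewrite -[in RHS]signr_odd scaler_sign -mulr_sign signr_odd.
have [h1 h2] : sorted gtn (shifts r (config N mu) ts) /\ size (shifts r (config N mu) ts) = N.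
  have ss := config_sorted N mu.
  move: tsP; rewrite mem_polyribbon_targets // => /and3P[_ vt _].
  by have [? ->] := size_shifts r0 ss vt; rewrite size_config.
by rewrite (leq_trans (size_part_of _)) // h2.
Qed.

End OneAlphabet.

(** * Types *)

Definition part0 : intpart := @IntPart [::] isT.

Lemma block_ge_total : total block_ge.
Proof.
by move=> [a b] [c d]; rewrite /block_ge /=; lia.
Qed.

Lemma block_ge_anti : antisymmetric block_ge.
Proof.
move=> [a b] [c d]; rewrite /block_ge /= => h.
have ac : pval a = pval c by lia.
have bd : pval b = pval d by lia.
by rewrite (pval_inj ac) (pval_inj bd).
Qed.

Lemma count_restr (tau : ptype) (b : block) :
  count_mem b tau = count_mem (pval b.2) (restr tau b.1).
Proof.
rewrite count_map count_filter; apply: eq_count => -[x y] /=.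
case: b => a b; rewrite xpair_eqE andbC.
by rewrite -[x == a]val_eqE -[y == b]val_eqE.
Qed.

(** Both lists of blocks are sorted for one total order, so the multiplicity of each block, which
    the restrictions record, determines them. *)
Lemma restr_inj (tau sg : ptype) : (forall k : pnat, restr tau k = restr sg k) -> tau = sg.
Proof.
move=> h; apply: val_inj; apply: (sorted_eq block_ge_trans block_ge_anti).
- exact: (valP tau).
- exact: (valP sg).
by apply/allP => b _ /=; rewrite !count_restr h.
Qed.

(** The fallback [psucc 0] of [insubd] would be used only for a part 0, which a partition does not
    have. *)
Fixpoint mkblocks K (c : nat -> seq nat) : seq block :=
  if K is K'.+1 then [seq (psucc K', insubd (psucc 0) x) | x <- c K'] ++ mkblocks K' c
  else [::].

Lemma mkblocks_sorted K c : sorted block_ge (sort block_ge (mkblocks K c)).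
Proof. exact/sort_sorted/block_ge_total. Qed.

(* The type whose multiplicities of degree i + 1 form the i-th partition of c. *)
Definition mkptype (c : seq intpart) : ptype :=
  PType (mkblocks_sorted (size c) (fun i => nth part0 c i)).

Lemma restr_mkblocks K (c : nat -> seq nat) (k : nat) : (forall i, all (ltn 0) (c i)) ->
  [seq pval b.2 | b : block <- mkblocks K c & pval b.1 == k] =
  if (0 < k <= K)%N then c k.-1 else [::].
Proof.
move=> c0; elim: K => [|K IH] /=; first by case: k.
rewrite filter_cat map_cat {}IH; have [kK|kK] := eqVneq k K.+1.
  rewrite kK leqnn ltnn /= cats0.
  have -> : [seq b : block <- [seq (psucc K, insubd (psucc 0) x) | x <- c K] | pval b.1 == K.+1] =
    [seq (psucc K, insubd (psucc 0) x) | x <- c K].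
    by apply/all_filterP/allP => _ /mapP[x _ ->] /=.
  rewrite -map_comp -[RHS]map_id; apply/eq_in_map => x xc /=.
  have -> // := @insubdK nat (ltn 0) pnat (psucc 0) x.
  exact: (allP (c0 K)).
have -> : [seq b : block <- [seq (psucc K, insubd (psucc 0) x) | x <- c K] | pval b.1 == k] = [::].
  apply/eqP; rewrite -[_ == _]negbK -has_filter; apply/hasPn => _ /mapP[x _ ->] /=.
  by rewrite eq_sym.
by rewrite /= [(k <= K.+1)%N]leq_eqVlt (negPf kK) /= ltnS.
Qed.

Lemma restr_mkptype c (k : nat) : (0 < k)%N -> restr (mkptype c) k = nth part0 c k.-1.
Proof.
move=> k0; apply: val_inj; apply: (sorted_eq geq_trans) => [x y /= h| | |].
- by apply/eqP; rewrite eqn_leq andbC.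
- exact: intpart_sorted.
- exact: intpart_sorted.
have -> : val (nth part0 c k.-1) = if (0 < k <= size c)%N then val (nth part0 c k.-1) else [::].
  by rewrite k0 /=; case: leqP => // ck; rewrite nth_default //; lia.
rewrite -(restr_mkblocks (size c) k (c := fun i => nth part0 c i)); last first.
  by move=> i; exact: intpart_pos.
by apply/perm_map/perm_filter; rewrite perm_sort.
Qed.

Definition deg_bounded K (tau : ptype) := forall k : pnat, (K < k)%N -> restr tau k = part0.

Lemma deg_bounded_mkptype c : deg_bounded (size c) (mkptype c).
Proof. by move=> k kc; rewrite restr_mkptype ?(valP k) // nth_default //; lia. Qed.

Lemma ex_deg_bounded (tau : ptype) : deg_bounded (\max_(b <- blocks tau) pval b.1) tau.
Proof.
move=> k kc; apply: val_inj => /=.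
suff -> : [seq b <- blocks tau | pval b.1 == k] = [::] by [].
apply/eqP; rewrite -[_ == _]negbK -has_filter; apply/hasPn => b bt.
rewrite neq_ltn; apply/orP; left; apply: leq_ltn_trans kc.
exact: (@leq_bigmax_seq _ _ xpredT (fun b : block => pval b.1)).
Qed.

Lemma deg_boundedW K K' tau : (K <= K')%N -> deg_bounded K tau -> deg_bounded K' tau.
Proof. by move=> KK h k kK; apply: h; apply: leq_ltn_trans kK. Qed.

Lemma schur0 k : schur k part0 = sone.
Proof.
apply/funext => m; rewrite /schur.
have e : ssyt part0 [::] by [].
have tm : tableau_monom k [::] = mone by rewrite /tableau_monom big_nil.
rewrite /sone; have [->|m1] := eqVneq m mone.
  rewrite (_ : [set T | _] = [set [::]]) ?fsbig_set1 //.
  apply/seteqP; split=> [T [/and3P[/eqP sT _ _] _]|_ ->] /=; last by rewrite tm.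
  by case: T sT.
rewrite fsbig1 // => T [/and3P[/eqP sT _ _]].
by case: T sT => // _; rewrite tm => e'; rewrite e' eqxx in m1.
Qed.

Definition pnats K : seq pnat := [seq psucc i | i <- iota 0 K].

Lemma fsbig_pnat (R : Type) (idx : R) (op : Monoid.com_law idx) K (F : pnat -> R) :
  (forall k : pnat, (K < k)%N -> F k = idx) ->
  \big[op/idx]_(k \in [set: pnat]) F k = \big[op/idx]_(i < K) F (psucc i).
Proof.
move=> F0; rewrite (@fsbigE _ _ _ _ _ (pnats K)) //.
- under eq_bigl do rewrite in_setT.
  by rewrite big_map -[iota 0 K](_ : index_iota 0 K = _) ?big_mkord // /index_iota subn0.
- by rewrite map_inj_uniq ?iota_uniq // => i j /(congr1 pval) [].
move=> k _ kK; apply: F0; rewrite ltnNge; apply: contra kK => kK.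
apply/mapP; exists k.-1; first by rewrite mem_iota; have := valP k => /=; lia.
by apply: pval_inj => /=; rewrite prednK //; exact: (valP k).
Qed.

Lemma schur_tensorE K tau : deg_bounded K tau ->
  schur_tensor tau = \prod_(i < K) (schur (psucc i) (restr tau i.+1) : pser).
Proof.
by move=> tK; apply: fsbig_pnat => k kK; rewrite tK // schur0.
Qed.

Lemma polyribbon_sgn0 r la : (0 < r)%N -> polyribbon_sgn r la la = 1.
Proof.
move=> r0; rewrite (@polyribbon_sgn_chain r la la [::]) //= ?big_nil //.
by rewrite /ribbon_chain /= eqxx.
Qed.

Lemma tensor_sgnE K r tau sg : (0 < r)%N -> deg_bounded K tau -> deg_bounded K sg ->
  tensor_sgn r tau sg = \prod_(i < K) polyribbon_sgn r (restr tau i.+1) (restr sg i.+1).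
Proof.
move=> r0 tK sK; rewrite /tensor_sgn.
by apply: fsbig_pnat => k kK; rewrite tK // sK // polyribbon_sgn0.
Qed.

(** * Splitting H_(d^r) by the degrees of the variables *)

Definition degv : var -> nat := fun v => v.1.

(** A monomial of H_d involves only variables of degree at most d, so any bound K >= d gives the
    same series. Hence finitely many degrees matter. *)
Lemma HblockE K (b : block) : (b.1 <= K)%N ->
  Hblock b = hgen degv (fun v => v.1 <= K)%N b.2 b.1.
Proof.
case: b => d r /= dK; have r0 : (0 < r)%N := valP r.
apply/funext => m; rewrite /Hblock /power_vars /hgen /=.
case: (boolP (all (fun v : var => r %| m v)%N (supp m))) => [/all_supp dv|ndv]; last first.
  rewrite (_ : all _ _ = false) ?fsbig1 //=.
    move=> m' /= e; case/all_supp: ndv => v _.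
    by rewrite -e expcmnE dvdn_mulr.
  by apply: contraNF ndv; apply: sub_all => v /andP[].
(* The only possible preimage of m under the r-th power. *)
pose m' : monom := [cmonom (m v %/ r)%N | v in supp m]%M.
have m'E (v : var) : m' v = (m v %/ r)%N.
  rewrite /m' cmE /= fsfunE; case: ifP => // /negbT.
  by rewrite -cmE_eq0 => /eqP ->; rewrite div0n.
have mE : expcmn m' r = m.
  apply: monomP => v; rewrite expcmnE m'E mulnC divnK //.
  by case: (posnP (m v)) => [->|/dv].
rewrite (_ : [set _ | _] = [set m']); last first.
  apply/seteqP; split=> [p /= e|_ ->] //; apply: monomP => v.
  by rewrite m'E -e expcmnE mulKn.
rewrite fsbig_set1 /Hdeg; congr (_%:R); congr nat_of_bool.
have wE : wt degv m = (weight m' * r)%N.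
  rewrite -[weight m']/(wt degv m') (@wtE _ m' (supp m)).
    by rewrite /wt big_distrl /=; apply: eq_bigr => v _; rewrite -{1}mE expcmnE mulnCA mulnC.
  by apply/fsubsetP => v; rewrite -!cmE_neq0 m'E; apply: contra => /eqP ->; rewrite div0n.
rewrite wE eqn_pmul2r // andb_idl // => /eqP wd.
apply/all_supp => v mv; rewrite (dv v mv) andbT (leq_trans _ dK) //.
have : (v.1 * m v <= d * r)%N.
  rewrite -wd -wE /wt (big_fsetD1 v) /= ?leq_addr //.
  by rewrite -cmE_neq0 -lt0n.
have : (r <= m v)%N by rewrite dvdn_leq // dv.
by move=> rm h; rewrite -(leq_pmul2r r0) (leq_trans _ h) // leq_mul2l rm orbT.
Qed.

Lemma wt_kvar (k : pnat) (m : monom) : all (kvar k) (supp m) ->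
  wt degv m = (wt (fun=> 1%N) m * k)%N.
Proof.
move=> /allP h; rewrite /wt big_distrl /=; apply: eq_big_seq => v /h /eqP e.
by rewrite /degv e mul1n mulnC.
Qed.

(** In the variables of degree k, the weight is k times the ordinary degree, so only multiples of k
    contribute. *)
Lemma hgen_kvar (k : pnat) r b : (0 < r)%N ->
  hgen degv (kvar k) r b = if (k %| b)%N then hgen (fun=> 1%N) (kvar k) r (b %/ k) else 0.
Proof.
move=> r0; apply/funext => m; have k0 : (0 < k)%N := valP k.
case: (boolP (all (kvar k) (supp m))) => mk; last first.
  by rewrite hgen_out //; case: ifP => _; rewrite ?hgen_out ?pser0E.
have we : all (fun v => kvar k v && (r %| m v)%N) (supp m) ->
    wt (fun=> 1%N) m = (wt (fun=> 1%N) m %/ r * r)%N.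
  move=> h; rewrite divnK // dvdn_wt //; apply: sub_all h => v /andP[] //.
case: ifP => kb; rewrite ?pser0E /hgen (wt_kvar mk);
  case: (boolP (all _ (supp m))) => //= /we ->; rewrite mulnAC eqn_pmul2r //.
  by rewrite -{1}(divnK kb) !eqn_pmul2r.
by case: eqP => // e; rewrite -e dvdn_mull in kb.
Qed.

Lemma sum_dvdn (F : nat -> pser) (k d : nat) : (0 < k)%N ->
  \sum_(b < d.+1 | (k %| b)%N) F b = \sum_(n <- iota 0 d.+1 | (n * k <= d)%N) F (n * k)%N.
Proof.
move=> k0; rewrite -(big_mkord (fun b => (k %| b)%N)) /index_iota subn0.
rewrite -big_filter -[RHS]big_filter -(big_map (fun n => (n * k)%N) xpredT F).
apply: perm_big; apply: uniq_perm; first by rewrite filter_uniq ?iota_uniq.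
  rewrite map_inj_uniq ?filter_uniq ?iota_uniq // => x y /eqP.
  by rewrite eqn_pmul2r // => /eqP.
move=> b; rewrite mem_filter mem_iota add0n ltnS leq0n andTb; apply/andP/mapP.
  case=> /dvdnP[n ->] nd; exists n => //; rewrite mem_filter nd mem_iota add0n ltnS.
  by rewrite (leq_trans _ nd) // leq_pmulr.
by case=> n; rewrite mem_filter => /andP[nd _] ->; rewrite dvdn_mull.
Qed.

(* The lists c of K partitions such that, for some exponents n_i with
   \sum_i n_i (i + 1) = d, each c_i / sg_i is an r^(n_i)-polyribbon. *)
Fixpoint tensor_shapes (r : nat) (sg : nat -> intpart) (K d : nat) : seq (seq intpart) :=
  if K is K'.+1 then
    flatten [seq [seq rcons c la | c <- tensor_shapes r sg K' (d - n * K'.+1)%N,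
                                   la <- polyribbons r n (sg K')]
            | n <- iota 0 d.+1 & (n * K'.+1 <= d)%N]
  else if d == 0%N then [:: [::]] else [::].

Lemma tensor_shapesS r sg K d : tensor_shapes r sg K.+1 d =
  flatten [seq [seq rcons c la | c <- tensor_shapes r sg K (d - n * K.+1)%N,
                                 la <- polyribbons r n (sg K)]
          | n <- iota 0 d.+1 & (n * K.+1 <= d)%N].
Proof. by []. Qed.

Lemma size_tensor_shapes r sg K d c : c \in tensor_shapes r sg K d -> size c = K.
Proof.
elim: K d c => [|K IH] d c; first by rewrite /=; case: eqP => // _; rewrite inE => /eqP ->.
rewrite tensor_shapesS; case/flattenP => _ /mapP[n _ ->] /allpairsP[[c' la] /= [/IH <- _ ->]].
by rewrite size_rcons.
Qed.

Lemma tensor_shapesP r sg K d c : (0 < r)%N -> c \in tensor_shapes r sg K d <->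
  size c = K /\ exists2 ns : nat -> nat, (\sum_(i < K) ns i * i.+1)%N = d &
    forall i, (i < K)%N -> is_polyribbon r (ns i) (nth part0 c i) (sg i).
Proof.
move=> r0; elim: K d c => [|K IH] d c.
  rewrite /=; split.
    case: eqP => // ->; rewrite inE => /eqP ->; split=> //.
    by exists (fun=> 0%N); rewrite ?big_ord0.
  by case=> sc [ns <- _]; rewrite big_ord0 eqxx inE (size0nil sc).
rewrite tensor_shapesS; split.
  case/flattenP => _ /mapP[n + ->] /allpairsP[[c' la] /= [c'in lain ->]].
  rewrite mem_filter => /andP[nd _].
  have [sc [ns nsd h]] := (IH _ _).1 c'in.
  split; first by rewrite size_rcons sc.
  exists (fun i => if i == K then n else ns i).
    rewrite big_ord_recr /= eqxx -[RHS](subnK nd) -nsd; congr (_ + _)%N.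
    by apply: eq_bigr => i _; rewrite ltn_eqF.
  move=> i; rewrite ltnS leq_eqVlt nth_rcons sc => /predU1P[->|iK].
    by rewrite ltnn eqxx; exact/polyribbonsP.
  by rewrite iK ltn_eqF //; exact: h.
case=> sc [ns nsd h]; apply/flattenP.
have nd : (ns K * K.+1 <= d)%N by rewrite -nsd big_ord_recr leq_addl.
exists [seq rcons c la | c <- tensor_shapes r sg K (d - ns K * K.+1)%N,
                         la <- polyribbons r (ns K) (sg K)].
  apply/mapP; exists (ns K) => //; rewrite mem_filter nd mem_iota add0n ltnS /=.
  by apply: leq_trans nd; rewrite leq_pmulr.
case/lastP: c sc h => // c la; rewrite size_rcons => -[sc] h.
apply/allpairsP; exists (c, la); split=> //=; last first.
  by apply/polyribbonsP => //; have := h K (ltnSn K); rewrite nth_rcons sc ltnn eqxx.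
apply/IH; split=> //; exists ns; first by rewrite -nsd big_ord_recr addnK.
by move=> i iK; have := h i (ltnW iK); rewrite nth_rcons sc iK.
Qed.

Lemma polyribbon_sumn r n (la mu : intpart) :
  is_polyribbon r n la mu -> sumn la = (sumn mu + r * n)%N.
Proof. by case=> gs [<- /and3P[/chain_size[_ +] /eqP <- _]]. Qed.

(** The lists for different n are disjoint, because n can be read off the last partition: an
    r^n-polyribbon adds r n boxes. *)
Lemma tensor_shapes_uniq r sg K d : (0 < r)%N -> uniq (tensor_shapes r sg K d).
Proof.
move=> r0; elim: K d => [|K IH] d; first by rewrite /=; case: eqP.
rewrite tensor_shapesS; set L := filter _ _; have uL : uniq L by rewrite filter_uniq ?iota_uniq.
elim: L uL => [//|n L IHL] /= /andP[nL uL]; rewrite cat_uniq IHL // andbT.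
apply/andP; split.
  apply: allpairs_uniq => //; first exact: polyribbons_uniq.
  by move=> [c la] [c' la'] _ _ /rcons_inj[-> ->].
apply/hasPn => x /flattenP[_ /mapP[n' n'L ->] /allpairsP[[c la] /= [_ lain ->]]].
apply/negP => /allpairsP[[c' la'] /= [_ lain' /rcons_inj[_ e]]].
move: lain lain' => /(polyribbonsP _ _ _ r0)/polyribbon_sumn h.
move=> /(polyribbonsP _ _ _ r0)/polyribbon_sumn; rewrite -e h => /addnI/eqP.
by rewrite eqn_pmul2l // => /eqP nn; rewrite -nn n'L in nL.
Qed.

(** Induction on the largest degree: the variables of degree K + 1 take a share n (K + 1) of d, and
    their complete function meets only the Schur factor in the same variables. *)
Lemma schur_prod_hgen r (sg : nat -> intpart) K d : (0 < r)%N ->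
  \prod_(i < K) (schur (psucc i) (sg i) : pser) * hgen degv (fun v => v.1 <= K)%N r d =
  \sum_(c <- tensor_shapes r sg K d) \prod_(i < K)
    (polyribbon_sgn r (nth part0 c i) (sg i) *: (schur (psucc i) (nth part0 c i) : pser)).
Proof.
move=> r0; elim: K d => [|K IH] d.
  rewrite big_ord0 mul1r (eq_hgen _ _ _ (V' := pred0)) ?hgen0 //=; last first.
    by move=> v; rewrite leqNgt (valP v.1).
  by case: eqP => _; rewrite ?big_nil // big_seq1 big_ord0.
have -> : hgen degv (fun v : var => v.1 <= K.+1)%N r d =
    \sum_(n <- iota 0 d.+1 | (n * K.+1 <= d)%N)
      hgen degv (fun v => v.1 <= K)%N r (d - n * K.+1) *
      hgen (fun=> 1%N) (kvar (psucc K)) r n.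
  rewrite (eq_hgen _ _ _ (V' := predU (kvar (psucc K)) (fun v : var => v.1 <= K)%N)); last first.
    move=> [a b]; rewrite /kvar /= -[a == _]val_eqE /=.
    by rewrite leq_eqVlt ltnS.
  rewrite hgenU //; last first.
    by move=> [a b]; rewrite /kvar /= => /eqP -> /=; rewrite -ltnNge.
  under eq_bigr => a _ do rewrite hgen_kvar // mulrC (fun_if ( *%R _)) mulr0.
  rewrite -big_mkcond /=.
  rewrite (@sum_dvdn (fun b => hgen degv (fun v => v.1 <= K)%N r (d - b) *
     hgen (fun=> 1%N) (kvar (psucc K)) r (b %/ K.+1)) K.+1 d) //.
  by apply: eq_bigr => n _; rewrite mulnK.
rewrite tensor_shapesS big_ord_recr mulr_sumr big_flatten big_map big_filter.
apply: eq_bigr => n nd; rewrite big_allpairs_dep /=.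
rewrite mulrACA IH one_alphabet // mulr_suml; apply: eq_big_seq => c cin.
rewrite mulr_sumr; apply: eq_bigr => la _.
have sc := size_tensor_shapes cin.
rewrite [RHS]big_ord_recr [nth part0 (rcons c la) _]nth_rcons sc ltnn eqxx.
by under [in RHS]eq_bigr => i _ do rewrite nth_rcons sc /= ltn_ord.
Qed.

Lemma sumn_count K (l : seq nat) : all (fun x => 0 < x <= K)%N l ->
  (\sum_(i < K) count_mem i.+1 l * i.+1)%N = sumn l.
Proof.
elim: l => [|x l IH] /=; first by rewrite big1.
move=> /andP[/andP[x0 xK] /IH <-]; under eq_bigr do rewrite mulnDl.
rewrite big_split /=; congr (_ + _)%N.
have xK' : (x.-1 < K)%N by rewrite prednK.
rewrite (bigD1 (Ordinal xK')) //= prednK // eqxx mul1n big1 ?addn0 // => i.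
rewrite -val_eqE /= => ne; by case: eqP => // e; rewrite e /= eqxx in ne.
Qed.

Lemma ex_part_of_mult (ns : nat -> nat) K : exists la : intpart,
  sumn la = (\sum_(i < K) ns i * i.+1)%N /\
  forall k, mult k la = if (0 < k <= K)%N then ns k.-1 else 0%N.
Proof.
pose l := flatten [seq nseq (ns i) i.+1 | i <- iota 0 K].
have lP : sorted geq (sort geq l) && all (ltn 0) (sort geq l).
  rewrite sort_sorted ?all_sort; last by move=> a b; exact: leq_total.
  by apply/allP => x /flattenP[_ /mapP[i _ ->] /nseqP[->]].
exists (IntPart lP); split.
  rewrite /= (perm_sumn (_ : perm_eq _ l)) ?perm_sort //.
  rewrite /l sumn_flatten -map_comp -(big_mkord xpredT (fun i => ns i * i.+1)%N).
  rewrite sumnE big_map /index_iota subn0; apply: eq_bigr => i _ /=.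
  by rewrite sumn_nseq mulnC.
move=> k; rewrite /mult /= (seq.permP (_ : perm_eq _ l)) ?perm_sort // /l {l lP}.
elim: K => [|K IH]; first by case: k.
rewrite -addn1 iotaD map_cat flatten_cat count_cat {}IH add0n /= cats0 count_nseq /=.
rewrite addn1; have [<-|ne] := eqVneq K.+1 k.
  by rewrite ltnn leqnn /= mul1n.
by rewrite mul0n addn0 [(k <= K.+1)%N]leq_eqVlt [k == _]eq_sym (negPf ne) /= ltnS.
Qed.

Lemma polyribbon_nil r (la mu : intpart) : is_polyribbon r 0 la mu -> la = mu.
Proof. by case=> -[|g gs] [// _ /and3P[_ /eqP]]. Qed.

Lemma is_polyribbon0 r (la : intpart) : is_polyribbon r 0 la la.
Proof. by exists [::]; rewrite /ribbon_chain /= eqxx. Qed.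

(** Above this degree sg has no blocks and a partition of d has no parts, so nothing can be added
    there. *)
Definition degree_bound (b : block) (sg : ptype) : nat :=
  maxn b.1 (\max_(c <- blocks sg) pval c.1).

Definition tensor_polyribbons (b : block) (sg : ptype) : seq ptype :=
  [seq mkptype c | c <- tensor_shapes b.2 (fun i => restr sg i.+1) (degree_bound b sg) b.1].

Section TensorStep.
Variables (b : block) (sg : ptype).
Let K := degree_bound b sg.
Let r0 : (0 < b.2)%N := valP b.2.

Let sgK : deg_bounded K sg.
Proof. by apply: deg_boundedW (@ex_deg_bounded sg); rewrite leq_maxr. Qed.

Let dK : (b.1 <= K)%N.
Proof. by rewrite leq_maxl. Qed.

Lemma mkptype_inj c c' : size c = size c' -> mkptype c = mkptype c' -> c = c'.
Proof.
move=> sc e; apply: (@eq_from_nth _ part0) => // i ic.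
by rewrite -[i]/(i.+1.-1) -!restr_mkptype // e.
Qed.

Lemma tensor_polyribbons_uniq : uniq (tensor_polyribbons b sg).
Proof.
rewrite map_inj_in_uniq ?tensor_shapes_uniq // => c c' h h'.
by apply: mkptype_inj; rewrite (size_tensor_shapes h) (size_tensor_shapes h').
Qed.

(** The partition of d and the exponents of [tensor_shapes] determine each other: the exponent at
    index i is the multiplicity of the part i + 1. *)
Lemma tensor_polyribbonsP tau :
  tau \in tensor_polyribbons b sg <-> is_tensor_polyribbon b tau sg.
Proof.
split=> [/mapP[c /(tensor_shapesP _ _ _ _ r0)[sc [ns nsd h]] ->]|[la [lad h]]].
  have [la [lad lam]] := ex_part_of_mult ns K.
  exists la; split=> [|k]; first by rewrite lad nsd.
  have k0 : (0 < k)%N := valP k; rewrite lam k0 /=; case: leqP => kK.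
    by rewrite restr_mkptype //; have := h k.-1; rewrite prednK //; exact.
  rewrite sgK // deg_bounded_mkptype ?sc //; exact: is_polyribbon0.
have laK : all (fun x => 0 < x <= K)%N la.
  apply/allP => x xla; have x0 : (0 < x)%N := allP (intpart_pos la) x xla.
  rewrite x0 (leq_trans _ dK) // -lad.
  elim: (parts la) xla => //= y l IH; rewrite inE => /predU1P[->|/IH /leq_trans].
    exact: leq_addr.
  by apply; exact: leq_addl.
have mulK k : (K < k)%N -> mult k la = 0%N.
  by move=> kK; apply/count_memPn/negP => /(allP laK) /andP[_]; rewrite leqNgt kK.
have tK : deg_bounded K tau.
  by move=> k kK; have := h k; rewrite mulK // => /polyribbon_nil ->; rewrite sgK.
pose c := mkseq (fun i => restr tau i.+1) K.
have sc : size c = K by rewrite size_mkseq.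
apply/mapP; exists c; last first.
  apply: restr_inj => k; have k0 : (0 < k)%N := valP k.
  rewrite restr_mkptype //; case: (leqP k K) => kK.
    by rewrite nth_mkseq prednK.
  by rewrite nth_default ?tK // sc -ltnS prednK.
apply/tensor_shapesP => //; split=> //.
exists (fun i => mult i.+1 la); first by rewrite sumn_count.
by move=> i iK; rewrite nth_mkseq //; exact: (h (psucc i)).
Qed.

Lemma schur_tensor_Hblock : smul (schur_tensor sg) (Hblock b) =
  \sum_(tau <- tensor_polyribbons b sg) tensor_sgn b.2 tau sg *: (schur_tensor tau : pser).
Proof.
rewrite (HblockE dK) (schur_tensorE sgK).
transitivity (\prod_(i < K) (schur (psucc i) (restr sg i.+1) : pser) *
   hgen degv (fun v => v.1 <= K)%N b.2 b.1); first by [].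
rewrite (schur_prod_hgen (fun i => restr sg i.+1)) // big_map.
apply: eq_big_seq => c cin; have sc := size_tensor_shapes cin.
have cK : deg_bounded K (mkptype c) by have := @deg_bounded_mkptype c; rewrite sc.
rewrite (tensor_sgnE r0 cK sgK) (schur_tensorE cK) -[RHS]scaler_prod.
by apply: eq_bigr => i _; rewrite restr_mkptype.
Qed.

End TensorStep.

(** * Tableaux *)

Fixpoint tprts (sg : ptype) (delta : seq block) : seq (seq ptype) :=
  if delta is b :: delta' then
    [seq sg :: T | tau <- tensor_polyribbons b sg, T <- tprts tau delta']
  else [:: [:: sg]].

Lemma tprts_head sg delta T : T \in tprts sg delta -> exists T', T = sg :: T'.
Proof.
case: delta => [|b delta] /=; first by rewrite inE => /eqP ->; exists [::].
by case/allpairsPdep => tau [T' [_ _ ->]]; exists T'.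
Qed.

Lemma tprts_uniq sg delta : uniq (tprts sg delta).
Proof.
elim: delta sg => [//|b delta IH] sg /=.
apply: allpairs_uniq_dep => [|tau _|]; [exact: tensor_polyribbons_uniq|exact: IH|].
move=> _ _ /allpairsPdep[t [T [_ + ->]]] /allpairsPdep[t' [T' [_ + ->]]] /= [e].
by rewrite -e => /tprts_head[T1 e1] /tprts_head[T2]; rewrite e1 => -[->].
Qed.

(** The final type is left free, so that one recursive enumeration covers the tableaux of all outer
    shapes at once. *)
Definition tprt_from (sg : ptype) (delta : seq block) (T : seq ptype) : Prop :=
  [/\ size T = (size delta).+1, nth sg T 0 = sg &
    forall i : 'I_(size delta), is_tensor_polyribbon
       (tnth (in_tuple delta) i) (nth sg T i.+1) (nth sg T i)].

Lemma tprtsP sg delta T : T \in tprts sg delta <-> tprt_from sg delta T.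
Proof.
elim: delta sg T => [|b delta IH] sg T /=.
  rewrite inE; split=> [/eqP ->|[]]; first by split=> // -[].
  by case: T => // t [|//] _ /= ->.
have step (i : 'I_(size delta)) (i1 : 'I_(size (b :: delta))) : val i1 = (val i).+1 ->
    tnth (in_tuple (b :: delta)) i1 = tnth (in_tuple delta) i.
  by move=> e; rewrite !(tnth_nth b) /= e.
split.
  case/allpairsPdep => tau [T' [tin T'in ->]].
  have [sz hd h] := (IH tau T').1 T'in.
  split=> //=; first by rewrite sz.
  case=> -[|i] ilt /=.
    rewrite (tnth_nth b) /=; have -> : nth sg T' 0 = tau.
      by case: (T') sz hd.
    exact/tensor_polyribbonsP.
  have ilt' : (i < size delta)%N by [].
  rewrite (step (Ordinal ilt')) //=.
  (* The default value passes from sg to tau; the index is in range, so the entry is the same. *)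
  have -> : nth sg T' i.+1 = nth tau T' i.+1 by apply: set_nth_default; rewrite sz.
  have -> : nth sg T' i = nth tau T' i by apply: set_nth_default; rewrite sz leqW.
  exact: (h (Ordinal ilt')).
case: T => [|t [|tau T']] [] //= [sz] tE h; rewrite tE in h *.
apply/allpairsPdep; exists tau, (tau :: T'); split=> //.
  by apply/tensor_polyribbonsP; have := h ord0; rewrite (tnth_nth b).
apply/IH; split=> //=; first by rewrite sz.
move=> i; have ilt : (i.+1 < size (b :: delta))%N by rewrite /= ltnS.
have := h (Ordinal ilt); rewrite (step i) //=.
have iT : (i < size T')%N by rewrite sz.
have -> : nth sg T' i = nth tau T' i by exact: set_nth_default.
by have -> : nth sg (tau :: T') i = nth tau (tau :: T') i by apply: set_nth_default; exact: leqW.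
Qed.

Lemma TPRT_sgn_cons b sg delta tau T : T \in tprts tau delta ->
  TPRT_sgn sg (b :: delta) (sg :: T) =
  tensor_sgn b.2 tau sg * TPRT_sgn tau delta T.
Proof.
move=> /tprtsP[sz hd _]; rewrite /TPRT_sgn big_ord_recl /= (tnth_nth b) /=.
congr (_ * _); first by case: T sz hd => //= t T _ ->.
apply: eq_bigr => i _; rewrite !(tnth_nth b) /=.
have -> : nth sg T i.+1 = nth tau T i.+1 by apply: set_nth_default; rewrite sz ltnS.
by have -> : nth sg T i = nth tau T i by apply: set_nth_default; rewrite sz leqW.
Qed.

Lemma TPRTE tau sg delta :
  TPRT tau sg delta = [set T | T \in tprts sg delta /\ last sg T = tau].
Proof.
apply/seteqP; split=> T /=.
  case=> sz hd lst h; split; first by apply/tprtsP.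
  by rewrite -nth_last sz.
by case=> /tprtsP[sz hd h] lst; split=> //; rewrite -lst -nth_last sz.
Qed.

Lemma schur_tensor_Hseq sg delta : smul (schur_tensor sg) (Hseq delta) =
  \sum_(T <- tprts sg delta) TPRT_sgn sg delta T *: (schur_tensor (last sg T) : pser).
Proof.
elim: delta sg => [|b delta IH] sg.
  rewrite /Hseq big_nil big_seq1 /TPRT_sgn big_ord0 scale1r /=.
  exact: (mulr1 (schur_tensor sg : pser)).
rewrite /Hseq big_cons -/(Hseq delta) smulA schur_tensor_Hblock /= big_allpairs_dep.
transitivity ((\sum_(tau <- tensor_polyribbons b sg)
   tensor_sgn b.2 tau sg *: (schur_tensor tau : pser)) * (Hseq delta : pser)); first by [].
rewrite mulr_suml; apply: eq_bigr => tau _.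
rewrite -scalerAl; transitivity
  (tensor_sgn b.2 tau sg *: (smul (schur_tensor tau) (Hseq delta) : pser)).
  by [].
rewrite IH scaler_sumr; apply: eq_big_seq => T Tin.
rewrite scalerA (TPRT_sgn_cons _ _ Tin) /=; congr (_ *: schur_tensor _).
by have [T' ->] := tprts_head Tin.
Qed.

(** An empty fibre has coefficient zero, so the sum over all j lives on the image of s under g; over
    this finite set the two summations can be exchanged. *)
Lemma fsbig_fiber (R : pzRingType) (V : lmodType R) (I J : choiceType) (s : seq I) (g : I -> J)
    (F : I -> R) (h : J -> V) : uniq s ->
  \sum_(j \in [set: J]) (\sum_(i \in [set i | i \in s /\ g i = j]) F i) *: h j =
  \sum_(i <- s) F i *: h (g i).
Proof.
move=> us; have fib j : \sum_(i \in [set i | i \in s /\ g i = j]) F i =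
    \sum_(i <- s | g i == j) F i.
  rewrite -[RHS]big_filter (@fsbig_seq _ _ _ _ [seq i <- s | g i == j]) ?filter_uniq //.
  apply: eq_fsbigl; apply/seteqP; split=> i /=; rewrite mem_filter.
    by case=> -> ->; rewrite eqxx.
  by case/andP=> /eqP.
rewrite (@fsbigE _ _ _ _ _ (undup [seq g i | i <- s])) ?undup_uniq //; last first.
  move=> j _; rewrite mem_undup => js; rewrite fib big1_seq ?scale0r // => i /andP[/eqP e si].
  by rewrite -e map_f in js.
under eq_bigl do rewrite in_setT.
under eq_bigr do rewrite fib scaler_suml.
rewrite (exchange_big_dep xpredT) //=; apply: eq_big_seq => i si.
rewrite -big_filter (_ : [seq j <- _ | _] = [:: g i]) ?big_seq1 //.
rewrite (eq_filter (a2 := pred1 (g i))); last by move=> j /=; rewrite eq_sym.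
by rewrite filter_pred1_uniq ?undup_uniq // mem_undup map_f.
Qed.

Theorem theorem21 (sigma : ptype) (delta : seq block) :
  smul (schur_tensor sigma) (Hseq delta) =
  \sum_(tau \in [set: ptype])
    (\sum_(T \in TPRT tau sigma delta) TPRT_sgn sigma delta T)
      *: schur_tensor tau.
Proof.
rewrite schur_tensor_Hseq.
transitivity (\sum_(T <- tprts sigma delta)
  TPRT_sgn sigma delta T *: schur_tensor (last sigma T)); first by [].
rewrite -(@fsbig_fiber rat series _ _ _ (fun T => last sigma T) _ schur_tensor) ?tprts_uniq //.
by apply: eq_fsbigr => tau _; rewrite TPRTE.
Qed.
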